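(* $R_{(7,7)} \leq 0.0408975$, $R_{(8,8)} \leq 0.0188887$, $R_{(9,8)} \leq 0.0561537$, $R_{(10,9)} \leq 0.0277279$, and $R_{(11,10)} \leq 0.0132033$.
   Context: For integers $b \geq k$ and $n$, a $(b,k)$-hash code of length $n$ is a subset $\mathcal{C} \subseteq \{1,2,\ldots,b\}^n$ such that for any $k$ distinct elements of $\mathcal{C}$ there is a coordinate $i \in \{1,\ldots,n\}$ in which their $i$-th entries are pairwise distinct. Let $N_{(b,k)}(n)$ denote the maximum size of a $(b,k)$-hash code of length $n$, and define $R_{(b,k)} = \limsup_{n\to\infty} \frac{1}{n}\log_2 N_{(b,k)}(n)$. *)

(* Defs.v *)
From HB Require Import structures.
From mathcomp Require Import all_boot all_order all_algebra.
From mathcomp Require Import all_classical all_reals all_analysis.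
Set Implicit Arguments. Unset Strict Implicit. Unset Printing Implicit Defensive.
Import Order.TTheory GRing.Theory Num.Theory.

Definition word (b n : nat) := {ffun 'I_n -> 'I_b}.

Definition is_hash_code (b k n : nat) (C : {set word b n}) : bool :=
  [forall S : {set word b n},
     ((S \subset C) && (#|S| == k)) ==>
     [exists i : 'I_n, [forall x in S, forall y in S, (x i == y i) ==> (x == y)]]].

Definition N_hash (b k n : nat) : nat :=
  \max_(C : {set word b n} | is_hash_code k C) #|C|.

Local Open Scope ring_scope.

Definition log2 {R : realType} (x : R) : R := ln x / ln 2.

Definition R_hash (R : realType) (b k : nat) : \bar R :=
  limn_esup (fun n : nat => ((n%:R)^-1 * log2 ((N_hash b k n)%:R) : R)%:E).

(* Main.v *)
(* Put d = k - 2 and let C be a (b,k)-hash code. For d distinct words of C the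
   remaining words are separated pairwise by complete multipartite graphs, one
   for each coordinate where the d words have distinct symbols, with b - d
   parts; by Hansel's lemma (N - d) ln (N - d) is at most ln (b - d) times the
   number of pairs (word v, coordinate) at which v and the d words have
   pairwise distinct symbols.

   The d words are drawn from the subcode of words whose first l symbols lie in
   a random product of cyclic windows of d - 1 symbols. They collide in these l
   coordinates, which therefore contribute nothing, and l can be a positive
   fraction of n as long as the subcode has many words. In a later coordinate
   the symbol distribution p_s of the subcode s differs from the distribution q
   of the whole code, but q is the average of the p_s, so one needs a bound for
   the average of T(p_s, p_t) over independent s and t, where T(p, q) is the
   probability that d symbols drawn from p and one from q are distinct. It is
   at most kappa = T(u, u), u uniform, because
     (T(p,q) + T(q,p)) / 2 <= kappa (1 + c (1/b - <p,q>))
   for a suitable c > 0, and <p_s, p_t> has average |q|^2 >= 1/b.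

   At a maximum of the difference of the two sides any two coordinates can be
   smoothed or pushed to the boundary, so that all pairs (p_a, q_a) with the
   same zero pattern coincide. This leaves finitely many polynomial
   inequalities in two masses in [0,1], which are settled by branch and bound. *)

Require Import Defs.
From Stdlib Require Import BinNat.
From HB Require Import structures.
From mathcomp Require Import all_boot all_order all_algebra.
From mathcomp Require Import ring lra zify.
From mathcomp Require Import all_classical all_reals all_analysis.
Set Implicit Arguments. Unset Strict Implicit. Unset Printing Implicit Defensive.
Import Order.TTheory GRing.Theory Num.Theory.
Import numFieldNormedType.Exports.
Local Open Scope ring_scope.

(** * Elementary sums over injective tuples *)

Section MixedSums.
Variable R : numDomainType.
Implicit Types (s t : seq (R * R)) (x : R * R).

(* Sums of products over injective tuples of positions: [esum_inj s j] is [j!]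
   times the [j]-th elementary symmetric polynomial in the first components;
   in [mixed_inj s j] one further position, distinct from the other [j],
   contributes its second component. *)
Fixpoint esum_inj s j : R :=
  match s, j with
  | _, 0 => 1
  | [::], _.+1 => 0
  | x :: s', j'.+1 => esum_inj s' j'.+1 + j'.+1%:R * x.1 * esum_inj s' j'
  end.

Fixpoint mixed_inj s j : R :=
  if s is x :: s' then
    mixed_inj s' j + (if j is j'.+1 then j%:R * x.1 * mixed_inj s' j' else 0)
      + x.2 * esum_inj s' j
  else 0.

Lemma esum_inj0 s : esum_inj s 0 = 1. Proof. by case: s. Qed.

Lemma esum_inj_consS x s j :
  esum_inj (x :: s) j.+1 = esum_inj s j.+1 + j.+1%:R * x.1 * esum_inj s j.
Proof. by []. Qed.

Lemma mixed_inj_consS x s j : mixed_inj (x :: s) j.+1 =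
  mixed_inj s j.+1 + j.+1%:R * x.1 * mixed_inj s j + x.2 * esum_inj s j.+1.
Proof. by []. Qed.

Lemma esum_inj_ge0 s j : all (fun x => 0 <= x.1) s -> 0 <= esum_inj s j.
Proof.
elim: s j => [|x s IH] [|j] //= /andP[x0 s0].
by rewrite addr_ge0 ?mulr_ge0 ?ler0n ?IH.
Qed.

Lemma mixed_inj_ge0 s j : all (fun x => (0 <= x.1) && (0 <= x.2)) s ->
  0 <= mixed_inj s j.
Proof.
elim: s j => [|x s IH] //= j /andP[/andP[x0 x1] s0].
have s1 : all (fun x => 0 <= x.1) s by apply: sub_all s0 => y /andP[].
case: j => [|j]; rewrite ?addr_ge0 ?mulr_ge0 ?ler0n ?IH ?esum_inj_ge0 //.
Qed.

(** Isolates two entries: only their sums and the products of their components occur. This drives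
    the smoothing argument. *)
Lemma mixed_inj_cons2 x y s j : mixed_inj [:: x, y & s] j.+2 =
  mixed_inj s j.+2 + j.+2%:R * (x.1 + y.1) * mixed_inj s j.+1
  + j.+2%:R * j.+1%:R * (x.1 * y.1) * mixed_inj s j
  + (x.2 + y.2) * esum_inj s j.+2
  + j.+2%:R * (x.1 * y.2 + x.2 * y.1) * esum_inj s j.+1.
Proof. rewrite !mixed_inj_consS !esum_inj_consS; ring. Qed.

Lemma esum_inj_swap x y s j : esum_inj [:: x, y & s] j = esum_inj [:: y, x & s] j.
Proof. by case: j => [|[|j]] //=; rewrite ?esum_inj0; ring. Qed.

Lemma mixed_inj_swap x y s j :
  mixed_inj [:: x, y & s] j = mixed_inj [:: y, x & s] j.
Proof.
by case: j => [|[|j]] //=; rewrite ?esum_inj0; ring.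
Qed.

Lemma esum_inj_cat x s t j : esum_inj (s ++ x :: t) j = esum_inj (x :: s ++ t) j.
Proof.
elim: s j => [|y s IH] j //=; rewrite -[RHS]esum_inj_swap.
by case: j => [|j] //; rewrite [LHS]/= [RHS]/= !IH; case: j.
Qed.

Lemma mixed_inj_cat x s t j :
  mixed_inj (s ++ x :: t) j = mixed_inj (x :: s ++ t) j.
Proof.
elim: s j => [|y s IH] j //; rewrite -[RHS]mixed_inj_swap.
by case: j => [|j]; rewrite [LHS]/= !IH !esum_inj_cat.
Qed.

Lemma esum_inj_perm s t j : perm_eq s t -> esum_inj s j = esum_inj t j.
Proof.
elim: s t j => [|x s IH] t j; first by rewrite perm_sym => /perm_nilP ->.
move=> st; have xt : x \in t by rewrite -(perm_mem st) mem_head.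
move: st; case/splitPr: xt => t1 t2; rewrite perm_sym -cat1s perm_catCA perm_cons.
rewrite perm_sym => st; rewrite esum_inj_cat.
by case: j => [|j] //=; rewrite !(IH _ _ st).
Qed.

Lemma mixed_inj_perm s t j : perm_eq s t -> mixed_inj s j = mixed_inj t j.
Proof.
elim: s t j => [|x s IH] t j; first by rewrite perm_sym => /perm_nilP ->.
move=> st; have xt : x \in t by rewrite -(perm_mem st) mem_head.
move: st; case/splitPr: xt => t1 t2; rewrite perm_sym -cat1s perm_catCA perm_cons.
rewrite perm_sym => st; rewrite mixed_inj_cat.
by case: j => [|j] /=; rewrite !(IH _ _ st) (esum_inj_perm _ st).
Qed.

Section Removal.
Variables (A : eqType) (p q : A -> R).
Implicit Types r : seq A.

Let pq a := (p a, q a).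

Lemma esum_inj_rem r j : uniq r ->
  esum_inj (map pq r) j.+1 = \sum_(a <- r) p a * esum_inj (map pq (rem a r)) j.
Proof.
elim: r j => [|x r IH] j /=; first by rewrite big_nil.
case/andP=> xr ur; rewrite big_cons eqxx (IH _ ur).
have -> : \sum_(a <- r) p a * esum_inj (map pq (if x == a then r else x :: rem a r)) j
   = \sum_(a <- r) p a * esum_inj (map pq (x :: rem a r)) j.
  rewrite !big_seq; apply: eq_bigr => a ar.
  by case: eqVneq => // xa; rewrite xa ar in xr.
case: j => [|j].
  rewrite !esum_inj0 mul1r addrC; congr (_ + _).
  by apply: eq_bigr => a _; rewrite !esum_inj0.
have -> : \sum_(a <- r) p a * esum_inj (map pq (x :: rem a r)) j.+1 =
   \sum_(a <- r) p a * esum_inj (map pq (rem a r)) j.+1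
   + j.+1%:R * p x * \sum_(a <- r) p a * esum_inj (map pq (rem a r)) j.
  by rewrite mulr_sumr -big_split; apply: eq_bigr => a _ /=; ring.
by rewrite -!IH // -[in j.+2%:R]natr1 /=; ring.
Qed.

(** Splitting by the position that contributes its second component makes linearity in [q]
    visible. *)
Lemma mixed_inj_rem r j : uniq r ->
  mixed_inj (map pq r) j = \sum_(a <- r) q a * esum_inj (map pq (rem a r)) j.
Proof.
elim: r j => [|x r IH] j /=; first by rewrite big_nil.
case/andP=> xr ur; rewrite big_cons eqxx (IH _ ur).
have -> : \sum_(a <- r) q a * esum_inj (map pq (if x == a then r else x :: rem a r)) j
   = \sum_(a <- r) q a * esum_inj (map pq (x :: rem a r)) j.
  rewrite !big_seq; apply: eq_bigr => a ar.
  by case: eqVneq => // xa; rewrite xa ar in xr.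
case: j => [|j].
  rewrite addr0 addrC; congr (_ + _).
  by apply: eq_bigr => a _; rewrite !esum_inj0.
rewrite (IH j ur) [RHS]addrC; congr (_ + _).
by rewrite mulr_sumr -big_split; apply: eq_bigr => a _ /=; ring.
Qed.

End Removal.
End MixedSums.

(** * A verified branch-and-bound search *)

Section Search.
Local Open Scope N_scope.

Definition grid : N := 512.

Fixpoint ffactN (b k : nat) : N :=
  if k is k'.+1 then N.of_nat b * ffactN b.-1 k' else 1.

(* For [cs = [:: c_0; ..; c_n]] the first component is the sum of the
   [c_s x^s y^(n-s)]. *)
Definition hom_eval (cs : seq N) (x y : N) : N * N :=
  foldl (fun ap c => (ap.1 * y + c * ap.2, ap.2 * x)) (0, 1) cs.

(* Coefficients, in the scaled masses [grid * l' * p] and [grid * i' * P], of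
   the sum [esum_inj] over [l] entries [p] and [i] entries [P]; [i'] and [l']
   are [i] and [l], or 1 when these vanish. *)
Definition esum_coefs (c : N) (i i' l l' d : nat) : seq N :=
  [seq c * (N.of_nat 'C(d, s) * ffactN l s * ffactN i (d - s)
            * N.of_nat l' ^ N.of_nat (d - s) * N.of_nat i' ^ N.of_nat s)
     | s <- iota 0 d.+1].

(** Bounds for one distribution with all shared entries available and with one of them removed. [x1]
    and [x2] enclose the scaled mass off the shared entries, so [grid - x1] bounds the shared
    mass. *)
Definition side (e e' : seq N) (x1 x2 : N) : N * N :=
  ((hom_eval e (grid - x1) x2).1, (hom_eval e' (grid - x1) x2).1).

(* [a1, a2] and [b1, b2] bound [grid] times the masses [alpha = i * P] and
   [beta = j * Q]. Every term of the form is a product, with a nonnegative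
   coefficient, of powers of [alpha], [1 - alpha], [beta], [1 - beta], so it is
   largest at [a2], [grid - a1], [b2], [grid - b1]. *)
Definition box_ok (c2 c3 : N) (A B : N * N) (a1 a2 b1 b2 : N) : bool :=
  let a' := grid - a1 in
  let b' := grid - b1 in
  b2 * A.1 + b' * A.2 + a2 * B.1 + a' * B.2 + c2 * (a' * b') <=? c3.

(* [va] and [vb] carry the values [fa a1 a2] and [fb b1 b2], of which each
   subdivision changes only one. *)
Fixpoint cover_ok (T : Type) (fuel : nat) (fa fb : N -> N -> T)
    (ok : T -> T -> N -> N -> N -> N -> bool) (va vb : T) (a1 a2 b1 b2 : N) : bool :=
  if ok va vb a1 a2 b1 b2 then true
  else if fuel is fuel'.+1 then
    if b2 - b1 <=? a2 - a1 then
      let a := N.div2 (a1 + a2) in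
      if cover_ok fuel' fa fb ok (fa a1 a) vb a1 a b1 b2
      then cover_ok fuel' fa fb ok (fa a a2) vb a a2 b1 b2 else false
    else
      let c := N.div2 (b1 + b2) in
      if cover_ok fuel' fa fb ok va (fb b1 c) a1 a2 b1 c
      then cover_ok fuel' fa fb ok va (fb c b2) a1 a2 c b2 else false
  else false.

(** With [l = 0] the unshared block carries the whole mass; with [l > 0] and an empty unshared block
    it carries none. Otherwise its scaled mass ranges over [[0, grid]]. The factors in [c1], [c2],
    [c3] clear all denominators. *)
Definition pattern_ok (fuel b d i j l : nat) : bool :=
  let lo k := if l is 0%N then grid else 0 in
  let hi k := if l is 0%N then grid else if k is 0%N then 0 else grid in
  let i' := maxn i 1 in
  let j' := maxn j 1 in
  let l' := maxn l 1 in
  let pow n k := N.of_nat n ^ N.of_nat k in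
  let F := ffactN b d.+1 in
  let c1 := 25 * N.of_nat b.-1 * pow b d.+1 in
  let c2 := 49 * N.of_nat b * F * (grid ^ N.of_nat d.-1 * pow i' d * pow j' d
                                   * pow l' d.-1) in
  let c3 := F * N.of_nat (50 * b).-1 * (grid ^ N.of_nat d.+1 * pow i' d
                                        * pow j' d * pow l' d) in
  let fa := side (esum_coefs (c1 * pow j' d) i i' l l' d)
                 (esum_coefs (c1 * pow j' d) i i' l.-1 l' d) in
  let fb := side (esum_coefs (c1 * pow i' d) j j' l l' d)
                 (esum_coefs (c1 * pow i' d) j j' l.-1 l' d) in
  cover_ok fuel fa fb (box_ok c2 c3)
    (fa (lo i) (hi i)) (fb (lo j) (hi j)) (lo i) (hi i) (lo j) (hi j).

Definition swap (T : Type) (x : T * T) := (x.2, x.1).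

(** Exchanging the two distributions swaps [i] and [j], so [j <= i] suffices; [0 < l + j] since the
    second distribution needs a nonempty support. *)
Definition search_ok (fuel b d : nat) : bool :=
  all (fun l => all (fun i => all (fun j =>
    if ((l + i + j <= b) && (0 < l + j))%N then pattern_ok fuel b d i j l else true)
    (iota 0 i.+1)) (iota 0 (b - l).+1)) (iota 0 b.+1).
End Search.

(** * Values of the sums on entries grouped into constant blocks *)

Section PatternValues.
Variable R : numDomainType.
Implicit Types (t : seq (R * R)) (x : R * R).

(** The binomial chooses which [s] of the [d] factors come from the constant block, the falling
    factorial places them there injectively. *)
Lemma esum_inj_nseq_cat i x t d : esum_inj (nseq i x ++ t) d =
  \sum_(s < d.+1) ('C(d, s) * i ^_ s)%:R * x.1 ^+ s * esum_inj t (d - s).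
Proof.
elim: i d => [|i IH] d.
  rewrite big_ord_recl big1 ?addr0 ?bin0 ?ffactn0 ?expr0 ?mul1r ?subn0 //= => s _.
  by rewrite ffact0n muln0 !mul0r.
case: d => [|d].
  by rewrite big_ord1 esum_inj0 bin0 ffactn0 expr0 !mul1r esum_inj0.
rewrite [nseq _ _ ++ _]/= esum_inj_consS !IH big_ord_recl [RHS]big_ord_recl.
rewrite !bin0 !ffactn0 -!addrA; congr (_ + _).
rewrite mulr_sumr -big_split; apply: eq_bigr => s _ /=.
rewrite /bump /= !add1n subSS ffactSS.
have -> : (i.+1 * i ^_ s = i ^_ s.+1 + s.+1 * i ^_ s)%N.
  rewrite ffactnSr; case: (leqP s i) => si; last by rewrite ffact_small // !muln0.
  have := subnKC si; move: (i - s)%N (i ^_ s)%N => e f <-; nia.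
have e : ('C(d.+1, s.+1) * (s.+1 * i ^_ s) = d.+1 * ('C(d, s) * i ^_ s))%N.
  by rewrite !mulnA (mulnC _ s.+1) mul_bin_diag.
by rewrite mulnDr e natrD !natrM exprS; ring.
Qed.

Lemma esum_inj_zero t d : all (fun x => x.1 == 0) t ->
  esum_inj t d = (d == 0%N)%:R.
Proof.
elim: t d => [|x t IH] [|d] //= /andP[/eqP-> t0].
by rewrite IH // mulr0 mul0r addr0.
Qed.

(** The marked position lies either in [t], where it contributes the factor [c], or in the block,
    where [l.-1] copies are left for the other positions. *)
Lemma mixed_inj_nseq_cat l x t c d :
  (forall e, mixed_inj t e = c * esum_inj t e) ->
  mixed_inj (nseq l x ++ t) d =
  c * esum_inj (nseq l x ++ t) d + l%:R * x.2 * esum_inj (nseq l.-1 x ++ t) d.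
Proof.
move=> ct; elim: l d => [|l IH] d; first by rewrite ct mul0r mul0r addr0.
have E e : l%:R * esum_inj (nseq l x ++ t) e.+1 = l%:R * (esum_inj (nseq l.-1 x ++ t) e.+1
     + e.+1%:R * x.1 * esum_inj (nseq l.-1 x ++ t) e) by case: l {IH}; rewrite ?mul0r.
case: d => [|d].
  by rewrite [LHS]/= IH !esum_inj0 -natr1; ring.
rewrite [LHS]/= !IH /= -[l.+1%:R]natr1.
rewrite (_ : (l%:R + 1) * x.2 * esum_inj (nseq l x ++ t) d.+1 =
  x.2 * (l%:R * esum_inj (nseq l x ++ t) d.+1) + x.2 * esum_inj (nseq l x ++ t) d.+1);
  last ring.
by rewrite E; ring.
Qed.

Definition pattern (P Q p q : R) (i j l m : nat) : seq (R * R) :=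
  nseq l (p, q) ++ nseq i (P, 0) ++ nseq j (0, Q) ++ nseq m (0, 0).

Definition esum_two (P p : R) (i l d : nat) : R :=
  \sum_(s < d.+1) ('C(d, s) * l ^_ s * i ^_ (d - s))%:R * p ^+ s * P ^+ (d - s).

Lemma esum_inj_pattern P Q p q i j l m d :
  esum_inj (pattern P Q p q i j l m) d = esum_two P p i l d.
Proof.
rewrite esum_inj_nseq_cat; apply: eq_bigr => s _ /=.
rewrite esum_inj_nseq_cat big_ord_recr big1 /= => [|r _].
  by rewrite add0r subnn esum_inj0 binn mul1n !natrM; ring.
rewrite esum_inj_zero; last by rewrite all_cat !all_nseq /= eqxx !orbT.
by rewrite subn_eq0 leqNgt ltn_ord mulr0.
Qed.

Lemma mixed_inj_pattern P Q p q i j l m d :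
  mixed_inj (pattern P Q p q i j l m) d =
  j%:R * Q * esum_two P p i l d + l%:R * q * esum_two P p i l.-1 d.
Proof.
rewrite (@mixed_inj_nseq_cat _ _ _ (j%:R * Q)) => [|e].
  by rewrite !esum_inj_pattern.
rewrite (@mixed_inj_nseq_cat _ _ _ (j%:R * Q)) => [|f].
  by rewrite mulr0 mul0r addr0.
rewrite (@mixed_inj_nseq_cat _ _ _ 0) => [|g].
  rewrite mul0r add0r /=; congr (_ * _).
  by rewrite !esum_inj_zero // all_cat !all_nseq /= eqxx !orbT.
by rewrite mul0r; elim: m g => [|m IH] [|g] //=; rewrite !IH ?mulr0 ?mul0r ?addr0.
Qed.

End PatternValues.

(** * Soundness of the interval bounds and of the subdivision *)

Section SearchSound.
Variable R : realFieldType.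

Definition toR (n : N) : R := (N.to_nat n)%:R.

Lemma toR0 : toR 0 = 0. Proof. by []. Qed.
Lemma toR_ge0 n : 0 <= toR n. Proof. exact: ler0n. Qed.
Lemma toRD m n : toR (m + n) = toR m + toR n.
Proof. by rewrite /toR Nnat.N2Nat.inj_add plusE natrD. Qed.
Lemma toRM m n : toR (m * n) = toR m * toR n.
Proof. by rewrite /toR Nnat.N2Nat.inj_mul multE natrM. Qed.
Lemma toR_nat n : toR (N.of_nat n) = n%:R.
Proof. by rewrite /toR Nnat.Nat2N.id. Qed.
Lemma toRX m n : toR (m ^ N.of_nat n) = toR m ^+ n.
Proof.
rewrite /toR Nnat.N2Nat.inj_pow Nnat.Nat2N.id.
elim: n => [|n IH] //=; by rewrite multE natrM IH exprS.
Qed.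
Lemma toR_le m n : (m <=? n)%num -> toR m <= toR n.
Proof. by move=> h; rewrite ler_nat; move: h => /N.leb_le; lia. Qed.
Lemma toR_sub m n : toR m - toR n <= toR (m - n).
Proof. by rewrite /toR lerBlDr -natrD ler_nat; lia. Qed.
Lemma toR_ffact i s : toR (ffactN i s) = (i ^_ s)%:R.
Proof.
by elim: s i => [|s IH] i //=; rewrite toRM IH toR_nat ffactnS natrM.
Qed.

Lemma hom_evalE (f : nat -> N) x y n :
  toR (hom_eval [seq f s | s <- iota 0 n.+1] x y).1 =
  \sum_(s < n.+1) toR (f s) * toR x ^+ s * toR y ^+ (n - s).
Proof.
pose g k := hom_eval [seq f s | s <- iota 0 k] x y.
have gS k : g k.+1 = ((g k).1 * y + f k * (g k).2, (g k).2 * x)%num.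
  by rewrite /g /hom_eval -addn1 iotaD map_cat foldl_cat.
have g2 k : toR (g k).2 = toR x ^+ k.
  by elim: k => [|k IH] //; rewrite gS toRM IH exprSr.
elim: n => [|n IH]; rewrite -/(g _) gS toRD !toRM g2.
  by rewrite big_ord1 toR0 mul0r add0r expr0 !mulr1.
rewrite IH [RHS]big_ord_recr /= subnn expr0 mulr1; congr (_ + _).
rewrite mulr_suml; apply: eq_bigr => s _.
by rewrite -mulrA -exprSr -subSn // -ltnS.
Qed.

(** All coefficients are nonnegative, so the mass bounds can be inserted term by term. For an empty
    block the falling factorial leaves only the zeroth power. *)
Lemma esum_two_bound c i i' l l' d (P p : R) x y :
  0 <= P -> 0 <= p ->
  ((0 < l)%N -> toR grid * l'%:R * p <= toR x) ->
  ((0 < i)%N -> toR grid * i'%:R * P <= toR y) ->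
  toR c * (toR grid * i'%:R * l'%:R) ^+ d * esum_two P p i l d <=
  toR (hom_eval (esum_coefs c i i' l l' d) x y).1.
Proof.
move=> P0 p0 hx hy; rewrite /esum_coefs hom_evalE mulr_sumr.
apply: ler_sum => s _; have sd : (s <= d)%N by rewrite -ltnS.
rewrite !(toRM, toRX, toR_ffact, toR_nat) !natrM.
rewrite -{1}(subnKC sd) exprD.
have g0 := toR_ge0 grid.
have hl : (l ^_ s)%:R * (toR grid * l'%:R * p) ^+ s <= (l ^_ s)%:R * toR x ^+ s.
  case: l hx => [|l] hx.
    by rewrite ffact0n; case: eqP => [->|]; rewrite ?expr0 ?mul0r.
  by rewrite ler_wpM2l ?ler0n // lerXn2r ?nnegrE ?mulr_ge0 ?ler0n ?toR_ge0 ?hx.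
have hi : (i ^_ (d - s))%:R * (toR grid * i'%:R * P) ^+ (d - s) <=
          (i ^_ (d - s))%:R * toR y ^+ (d - s).
  case: i hy => [|i] hy.
    by rewrite ffact0n; case: eqP => [->|]; rewrite ?expr0 ?mul0r.
  by rewrite ler_wpM2l ?ler0n // lerXn2r ?nnegrE ?mulr_ge0 ?ler0n ?toR_ge0 ?hy.
have := ler_pM _ _ hl hi.
rewrite !mulr_ge0 ?exprn_ge0 ?mulr_ge0 ?ler0n // => /(_ isT isT) h.
have k0 : 0 <= toR c * 'C(d, s)%:R * i'%:R ^+ s * l'%:R ^+ (d - s).
  by rewrite !mulr_ge0 ?toR_ge0 ?exprn_ge0 ?ler0n.
have := ler_wpM2l k0 h; rewrite !exprMn => hh.
by apply: le_trans (le_trans hh _); rewrite le_eqVlt; apply/orP; left; apply/eqP; ring.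
Qed.

(** Induction on the depth: whatever cut is chosen, a point of the box lies on one side of it. *)
Lemma cover_okP (T : Type) (fa fb : N -> N -> T)
    (ok : T -> T -> N -> N -> N -> N -> bool) (good : R -> R -> Prop) fuel
    a1 a2 b1 b2 :
  (forall a1 a2 b1 b2, ok (fa a1 a2) (fb b1 b2) a1 a2 b1 b2 ->
     forall u v, toR a1 <= u <= toR a2 -> toR b1 <= v <= toR b2 -> good u v) ->
  cover_ok fuel fa fb ok (fa a1 a2) (fb b1 b2) a1 a2 b1 b2 ->
  forall u v, toR a1 <= u <= toR a2 -> toR b1 <= v <= toR b2 -> good u v.
Proof.
move=> okP; elim: fuel a1 a2 b1 b2 => [|fuel IH] a1 a2 b1 b2 /=.
  by case: ifP => // h _; exact: okP h.
case: ifP => [h _|_]; first exact: okP h.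
case: ifP => _; case: ifP => // h1 h2 u v /andP[u1 u2] /andP[v1 v2].
  have [ua|/ltW ua] := leP u (toR (N.div2 (a1 + a2))).
    by apply: IH h1 _ _ _ _; rewrite ?u1 ?v1.
  by apply: IH h2 _ _ _ _; rewrite ?ua ?v1.
have [va|/ltW va] := leP v (toR (N.div2 (b1 + b2))).
  by apply: IH h1 _ _ _ _; rewrite ?u1 ?v1.
by apply: IH h2 _ _ _ _; rewrite ?u1 ?va.
Qed.

(* With [kappa = b^_(d+1) / b^(d+1)] the inequality [pair_form <= pair_bound]
   reads, up to the positive factor [25 (b - 1) b^(d+1)],
   [T(p,q) + T(q,p) <= 2 kappa (1 + phi (b / (b - 1)) (1 / b - <p,q>))] where
   [phi = 49 / 50]. Any [phi] slightly below 1 would do. *)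
Definition pair_form (b d : nat) (s : seq (R * R)) : R :=
  (25 * b.-1)%:R * b%:R ^+ d.+1 * (mixed_inj s d + mixed_inj (map (@swap R) s) d)
  + (49 * b)%:R * (b ^_ d.+1)%:R * \sum_(x <- s) x.1 * x.2.

Definition pair_bound (b d : nat) : R := (b ^_ d.+1)%:R * (50 * b).-1%:R.

End SearchSound.

Section PatternSound.
Variable R : realFieldType.

Lemma toR_grid_gt0 : 0 < toR R grid.
Proof. by rewrite /toR ltr0n. Qed.

Local Opaque grid.

Lemma map_swap_pattern (P Q p q : R) i j l m :
  perm_eq (map (@swap R) (pattern P Q p q i j l m)) (pattern Q P q p j i l m).
Proof. by rewrite !map_cat !map_nseq /swap /= perm_cat2l perm_catCA. Qed.

Lemma sum_pattern (P Q p q : R) i j l m :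
  \sum_(x <- pattern P Q p q i j l m) x.1 * x.2 = l%:R * (p * q).
Proof.
rewrite !big_cat !big_nseq /= mulr0 !mul0r !iter_addr_0 !mul0rn !addr0.
by rewrite mulr_natl.
Qed.

Lemma esum_two_ge0 (P p : R) i l d : 0 <= P -> 0 <= p -> 0 <= esum_two P p i l d.
Proof.
by move=> P0 p0; apply: sumr_ge0 => s _; rewrite !mulr_ge0 ?exprn_ge0 ?ler0n.
Qed.

Lemma pattern_sound fuel b d i j l m (P Q p q : R) :
  0 <= P -> 0 <= Q -> 0 <= p -> 0 <= q ->
  i%:R * P + l%:R * p = 1 -> j%:R * Q + l%:R * q = 1 ->
  (0 < d)%N -> pattern_ok fuel b d i j l ->
  pair_form b d (pattern P Q p q i j l m) <= pair_bound R b d.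
Proof.
move=> P0 Q0 p0 q0 eP eQ d0 ok.
have [M ME] : exists M, M = toR R grid by exists (toR R grid).
have M0 : 0 < M by rewrite ME toR_grid_gt0.
have lp0 : 0 <= l%:R * p by rewrite mulr_ge0.
have lq0 : 0 <= l%:R * q by rewrite mulr_ge0.
have iP0 : 0 <= i%:R * P by rewrite mulr_ge0.
have jQ0 : 0 <= j%:R * Q by rewrite mulr_ge0.
have iP1 : i%:R * P <= 1 by clear ok; lra.
have jQ1 : j%:R * Q <= 1 by clear ok; lra.
have iPM : M * (i%:R * P) <= M.
  by rewrite -[leRHS]mulr1 ler_wpM2l ?(ltW M0) //.
have jQM : M * (j%:R * Q) <= M.
  by rewrite -[leRHS]mulr1 ler_wpM2l ?(ltW M0) //.
(* The claim concerns a single point of the box, the one given by the actual scaled masses. *)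
pose good u v := u = M * (i%:R * P) -> v = M * (j%:R * Q) ->
  pair_form b d (pattern P Q p q i j l m) <= pair_bound R b d.
suff H a1 a2 b1 b2 : box_ok
     (49 * N.of_nat b * ffactN b d.+1 *
       (grid ^ N.of_nat d.-1 * N.of_nat (maxn i 1) ^ N.of_nat d
        * N.of_nat (maxn j 1) ^ N.of_nat d * N.of_nat (maxn l 1) ^ N.of_nat d.-1))
     (ffactN b d.+1 * N.of_nat (50 * b).-1 *
       (grid ^ N.of_nat d.+1 * N.of_nat (maxn i 1) ^ N.of_nat d
        * N.of_nat (maxn j 1) ^ N.of_nat d * N.of_nat (maxn l 1) ^ N.of_nat d))
     (side
       (esum_coefs (25 * N.of_nat b.-1 * N.of_nat b ^ N.of_nat d.+1
        * N.of_nat (maxn j 1) ^ N.of_nat d) i (maxn i 1) l (maxn l 1) d)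
       (esum_coefs (25 * N.of_nat b.-1 * N.of_nat b ^ N.of_nat d.+1
        * N.of_nat (maxn j 1) ^ N.of_nat d) i (maxn i 1) l.-1 (maxn l 1) d)
       a1 a2)
     (side
       (esum_coefs (25 * N.of_nat b.-1 * N.of_nat b ^ N.of_nat d.+1
        * N.of_nat (maxn i 1) ^ N.of_nat d) j (maxn j 1) l (maxn l 1) d)
       (esum_coefs (25 * N.of_nat b.-1 * N.of_nat b ^ N.of_nat d.+1
        * N.of_nat (maxn i 1) ^ N.of_nat d) j (maxn j 1) l.-1 (maxn l 1) d)
       b1 b2)
     a1 a2 b1 b2 -> forall u v, toR R a1 <= u <= toR R a2 ->
     toR R b1 <= v <= toR R b2 -> good u v.
  apply: (cover_okP H ok) (erefl _) (erefl _).
    case: (l) (i) eP iPM iP0 => [|l1] [|i1] /= e h h0; rewrite -?ME.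
    - by move/eqP: e; rewrite !mul0r addr0 eq_sym oner_eq0.
    - by move: e; rewrite mul0r addr0 => ->; rewrite mulr1 !lexx.
    - by rewrite mul0r mulr0 toR0 !lexx.
    - by rewrite toR0 mulr_ge0 // ltW.
  case: (l) (j) eQ jQM jQ0 => [|l1] [|i1] /= e h h0; rewrite -?ME.
  - by move/eqP: e; rewrite !mul0r addr0 eq_sym oner_eq0.
  - by move: e; rewrite mul0r addr0 => ->; rewrite mulr1 !lexx.
  - by rewrite mul0r mulr0 toR0 !lexx.
  - by rewrite toR0 mulr_ge0 // ltW.
clear ok.
rewrite /box_ok /side; cbn [fst snd] => /(toR_le R) + u v /andP[u1 u2] /andP[v1 v2] uE vE.
set i' := maxn i 1; set j' := maxn j 1; set l' := maxn l 1.
have ub : M * (l%:R * p) <= toR R (grid - a1).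
  apply: le_trans (toR_sub _ _ _); rewrite -ME -[l%:R * p](addKr (i%:R * P)) eP.
  by move: u1; rewrite uE; clear; lra.
have vb : M * (l%:R * q) <= toR R (grid - b1).
  apply: le_trans (toR_sub _ _ _); rewrite -ME -[l%:R * q](addKr (j%:R * Q)) eQ.
  by move: v1; rewrite vE; clear; lra.
have natmax k : (0 < k)%N -> maxn k 1 = k by case: k => // k _; rewrite maxnS maxn0.
have l'E : (0 < l)%N -> l'%:R = l%:R :> R by move=> ?; rewrite /l' natmax.
have bnd c (i1 : nat) (P1 p1 : R) x y l1 : 0 <= P1 -> 0 <= p1 -> (l1 <= l)%N ->
   M * (l%:R * p1) <= toR R x -> M * (i1%:R * P1) <= toR R y ->
   toR R c * (M * (maxn i1 1)%:R * l'%:R) ^+ d * esum_two P1 p1 i1 l1 d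
   <= toR R (hom_eval (esum_coefs c i1 (maxn i1 1) l1 l' d) x y).1.
  move=> P10 p10 l1l hx hy; rewrite ME; apply: esum_two_bound; rewrite -?ME //.
    by move=> l10; rewrite -mulrA l'E // (leq_trans l10).
  by move=> i10; rewrite -mulrA natmax.
set c1 := (25 * _ * _)%num; set c2 := (49 * _ * _ * _)%num.
set h1 := (hom_eval _ _ _).1; set h2 := (hom_eval _ _ _).1.
set h3 := (hom_eval _ _ _).1; set h4 := (hom_eval _ _ _).1.
have uP : M * (i%:R * P) <= toR R a2 by rewrite -uE.
have vQ : M * (j%:R * Q) <= toR R b2 by rewrite -vE.
have H1 := bnd (c1 * N.of_nat j' ^ N.of_nat d)%num _ _ _ _ _ _ P0 p0 (leqnn l) ub uP.
have H2 := bnd (c1 * N.of_nat j' ^ N.of_nat d)%num _ _ _ _ _ _ P0 p0 (leq_pred l) ub uP.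
have H3 := bnd (c1 * N.of_nat i' ^ N.of_nat d)%num _ _ _ _ _ _ Q0 q0 (leqnn l) vb vQ.
have H4 := bnd (c1 * N.of_nat i' ^ N.of_nat d)%num _ _ _ _ _ _ Q0 q0 (leq_pred l) vb vQ.
rewrite -/h1 in H1; rewrite -/h2 in H2; rewrite -/h3 in H3; rewrite -/h4 in H4.
have [E1 E2] : 0 <= esum_two P p i l d /\ 0 <= esum_two P p i l.-1 d.
  by split; apply: esum_two_ge0.
have [E3 E4] : 0 <= esum_two Q q j l d /\ 0 <= esum_two Q q j l.-1 d.
  by split; apply: esum_two_ge0.
(* The marked draw contributes a mass; its bound is multiplied with the bound for the [d] other
   draws. *)
have T x y (c : N) (k : nat) e h : 0 <= x -> 0 <= e -> M * x <= y ->
    toR R c * (M * k%:R * l'%:R) ^+ d * e <= h ->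
    M * x * (toR R c * (M * k%:R * l'%:R) ^+ d * e) <= y * h.
  move=> x0 e0 xy eh; apply: ler_pM => //; first by rewrite mulr_ge0 // ltW.
  by rewrite !mulr_ge0 ?exprn_ge0 ?mulr_ge0 ?ler0n ?toR_ge0 // ltW.
have {}H1 := T _ _ _ _ _ _ jQ0 E1 vQ H1; have {}H2 := T _ _ _ _ _ _ lq0 E2 vb H2.
have {}H3 := T _ _ _ _ _ _ iP0 E3 uP H3; have {}H4 := T _ _ _ _ _ _ lp0 E4 ub H4.
have H5 : toR R c2 * (M * (l%:R * p) * (M * (l%:R * q))) <=
          toR R c2 * (toR R (grid - a1) * toR R (grid - b1)).
  by rewrite ler_wpM2l ?toR_ge0 // ler_pM // mulr_ge0 // ltW.
rewrite !(toRD, toRM, toRX, toR_nat, toR_ffact, prednK d0) -ME => H.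
(* The common denominator through which the real inequality becomes the integer one. *)
pose K := M ^+ d.+1 * i'%:R ^+ d * j'%:R ^+ d * l'%:R ^+ d.
have K0 : 0 < K by rewrite !mulr_gt0 ?exprn_gt0 // ltr0n leq_max orbT.
rewrite -(ler_pM2l K0) /pair_bound.
have -> : K * ((b ^_ d.+1)%:R * (50 * b).-1%:R) =
  (b ^_ d.+1)%:R * (50 * b).-1%:R *
     (M ^+ d.+1 * i'%:R ^+ d * j'%:R ^+ d * l'%:R ^+ d) by rewrite /K; ring.
apply: le_trans H.
rewrite /pair_form (mixed_inj_perm _ (map_swap_pattern _ _ _ _ _ _ _ _)).
rewrite !mixed_inj_pattern sum_pattern.
rewrite /c2 !(toRM, toRX, toR_nat, toR_ffact) -ME in H5.
apply: le_trans (lerD (lerD (lerD (lerD H1 H2) H3) H4) H5).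
rewrite /c1 !(toRM, toRX, toR_nat).
(* For [l = 0] the terms with shared mass vanish; otherwise [l' = l] and both sides agree as
   polynomials. *)
have [l0|l0] := posnP l.
  rewrite l0 /= !mul0r !mulr0 !addr0 /K !exprMn !natrM !exprS le_eqVlt.
  by apply/orP; left; apply/eqP; rewrite (_ : toR R 25 = 25%:R) //; ring.
rewrite le_eqVlt; apply/orP; left; apply/eqP.
rewrite /K -/i' -/j' -/l' l'E // !exprMn !natrM.
case: (d) d0 => // d1 _; rewrite /= !exprS.
rewrite (_ : toR R 25 = 25%:R) // (_ : toR R 49 = 49%:R) //; ring.
Qed.

End PatternSound.

Section Patterns.
Variable R : realFieldType.
Implicit Types s : seq (R * R).

Lemma pair_form_perm b d s t : perm_eq s t -> pair_form b d s = pair_form b d t.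
Proof.
move=> st; rewrite /pair_form (mixed_inj_perm _ st) (perm_big _ st) /=.
by rewrite (mixed_inj_perm _ (perm_map _ st)).
Qed.

Lemma pair_form_swap b d s : pair_form b d (map (@swap R) s) = pair_form b d s.
Proof.
have sK : cancel (@swap R) (@swap R) by case.
rewrite /pair_form (mapK sK) big_map [_ + mixed_inj s d]addrC.
by under eq_bigr => x _ do rewrite mulrC.
Qed.

Lemma all_same_nseq (T : eqType) (x0 : T) (r : seq T) :
  {in r &, forall x y, x = y} -> r = nseq (size r) (head x0 r).
Proof.
case: r => [|x r] //= h; congr (_ :: _); apply/all_pred1P/allP => y yr /=.
by apply/eqP/h; rewrite ?mem_head // inE yr orbT.
Qed.

Lemma pattern_of_types s :
  all (fun x => (0 <= x.1) && (0 <= x.2)) s ->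
  {in s &, forall x y, (x.1 == 0) = (y.1 == 0) -> (x.2 == 0) = (y.2 == 0) ->
     x = y} ->
  exists P Q p q i j l m, [/\ 0 <= P, 0 <= Q, 0 <= p & 0 <= q] /\
    perm_eq s (pattern P Q p q i j l m).
Proof.
(* [f u v] is the class with prescribed vanishing of the two components and [h u v] its common
   value, [(0, 0)] if the class is empty. *)
move=> s0 same; pose f u v := [seq x <- s | ((x.1 == 0) == u) && ((x.2 == 0) == v)].
pose z : R * R := (0, 0); pose h u v := head z (f u v).
have fE u v : f u v = nseq (size (f u v)) (h u v).
  apply: all_same_nseq => x y; rewrite !mem_filter.
  by case/andP=> /andP[/eqP e1 /eqP e2] xs /andP[/andP[/eqP e3 /eqP e4] ys];
    apply: same; rewrite ?e1 ?e2 ?e3 ?e4.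
have hP u v : (f u v == [::]) || (h u v \in f u v).
  by rewrite /h; case: (f u v) => //= x r; rewrite mem_head.
have h0 u v : 0 <= (h u v).1 /\ 0 <= (h u v).2.
  case/orP: (hP u v) => [/eqP e|]; first by rewrite /h e.
  by rewrite mem_filter => /andP[_ /(allP s0) /andP].
have h1 v : f true v = nseq (size (f true v)) (0, (h true v).2).
  case/orP: (hP true v) => [/eqP -> //|]; rewrite mem_filter.
  by case/andP=> /andP[/eqP/eqP e _] _; rewrite {1}fE; congr nseq; rewrite -e -surjective_pairing.
have h2 u : f u true = nseq (size (f u true)) ((h u true).1, 0).
  case/orP: (hP u true) => [/eqP -> //|]; rewrite mem_filter.
  by case/andP=> /andP[_ /eqP/eqP e] _; rewrite {1}fE; congr nseq; rewrite -e -surjective_pairing.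
have h3 : f true true = nseq (size (f true true)) (0, 0).
  by case/orP: (hP true true) => [/eqP -> //|]; rewrite mem_filter;
    case/andP=> /andP[_ /eqP/eqP e] _; rewrite {1}h1; congr nseq; rewrite e.
exists (h false true).1, (h true false).2, (h false false).1, (h false false).2.
exists (size (f false true)), (size (f true false)), (size (f false false)),
  (size (f true true)); split; first by split; apply h0.
rewrite /pattern -surjective_pairing -fE -h2 -h1 -h3 /f.
apply/permP => a; rewrite !count_cat !count_filter.
elim: (s) => [|x r IH] //=; rewrite {}IH.
by case: (x.1 == 0); case: (x.2 == 0); rewrite /= ?andbF ?andbT; lia.
Qed.

Lemma pair_form_pattern fuel b d P Q p q i j l m :
  search_ok fuel b d -> (0 < d)%N ->
  0 <= P -> 0 <= Q -> 0 <= p -> 0 <= q -> (l + i + j + m = b)%N ->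
  i%:R * P + l%:R * p = 1 -> j%:R * Q + l%:R * q = 1 ->
  pair_form b d (pattern P Q p q i j l m) <= pair_bound R b d.
Proof.
move=> ok d0; wlog ji : P Q p q i j / (j <= i)%N => [H|].
  have [ji|/ltnW ij] := leqP j i; first exact: H.
  move=> P0 Q0 p0 q0 e eP eQ.
  rewrite -pair_form_swap (pair_form_perm _ _ (map_swap_pattern _ _ _ _ _ _ _ _)).
  by apply: H => //; rewrite -e -!addnA (addnCA i).
move=> P0 Q0 p0 q0 e eP eQ; apply: pattern_sound => //.
have lj : (0 < l + j)%N.
  rewrite lt0n addn_eq0; apply/negP => /andP[/eqP l0 /eqP j0].
  by move/eqP: eQ; rewrite l0 j0 !mul0r addr0 eq_sym oner_eq0.
have /(_ l) := allP ok; rewrite mem_iota => /(_ _)/allP/(_ i).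
rewrite mem_iota => H.
have lij : (l + i + j <= b)%N by rewrite -e leq_addr.
have li : (l + i <= b)%N by apply: leq_trans lij; apply: leq_addr.
have hl : (0 <= l < 0 + b.+1)%N by rewrite add0n ltnS (leq_trans _ li) ?leq_addr.
have hi : (0 <= i < 0 + (b - l).+1)%N by rewrite add0n ltnS leq_subRL ?(leq_trans _ li) ?leq_addr.
have := H hl hi => /allP/(_ j); rewrite mem_iota add0n ltnS ji lij lj; exact.
Qed.

End Patterns.

(** * The two-distribution inequality *)

Section PairForm.
Variable R : realFieldType.

(** With the two sums fixed, the half-differences enter only through [(sg + x) * (sg - x)], its
    analogue for [tau], and the cross products. The squares get nonpositive coefficients because
    [mixed_inj] of the rest is nonnegative. *)
Lemma pair_form_two b d (rest : seq (R * R)) (sg tau : R) :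
  (1 < d)%N -> all (fun x => (0 <= x.1) && (0 <= x.2)) rest ->
  exists C A B G : R, [/\ 0 <= A, 0 <= B & forall x w,
    pair_form b d [:: (sg + x, tau + w), (sg - x, tau - w) & rest] =
    C - A * x ^+ 2 - B * w ^+ 2 + G * (x * w)].
Proof.
case: d => [|[|d]] // _ rest0.
have rest0' : all (fun x => (0 <= x.1) && (0 <= x.2)) (map (@swap R) rest).
  by rewrite all_map; apply: sub_all rest0 => x /=; rewrite andbC.
set k1 := (25 * b.-1)%:R * b%:R ^+ d.+3 : R.
set k2 := (49 * b)%:R * (b ^_ d.+3)%:R : R.
have k10 : 0 <= k1 * (d.+2%:R * d.+1%:R).
  exact: mulr_ge0 (mulr_ge0 (ler0n _ _) (exprn_ge0 _ (ler0n _ _)))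
    (mulr_ge0 (ler0n _ _) (ler0n _ _)).
set rs := map (@swap R) rest.
exists (pair_form b d.+2 [:: (sg, tau), (sg, tau) & rest]).
exists (k1 * (d.+2%:R * d.+1%:R) * mixed_inj rest d).
exists (k1 * (d.+2%:R * d.+1%:R) * mixed_inj rs d).
exists (2 * k2 - 2 * k1 * d.+2%:R * (esum_inj rest d.+1 + esum_inj rs d.+1)).
split; [by rewrite mulr_ge0 ?mixed_inj_ge0|by rewrite mulr_ge0 ?mixed_inj_ge0|].
move=> x w; rewrite /pair_form -/k1 -/k2 [map _ (_ :: _ :: _)]/= [map _ (_ :: _ :: _)]/=.
rewrite -/rs !mixed_inj_cons2 !big_cons /=; ring.
Qed.

(** Stretching the half-difference by [1 + mu] moves each entry by at most [mu / 2], less than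
    either entry. *)
Lemma scaled_halves (y z mu : R) : 0 <= y -> 0 <= z -> z <= 1 -> y <= 1 ->
  mu <= y -> mu <= z -> 0 < mu ->
  0 <= (y + z) / 2 + (1 + mu) * ((y - z) / 2) /\
  0 <= (y + z) / 2 - (1 + mu) * ((y - z) / 2).
Proof.
move=> y0 z0 z1 y1 my mz mu0.
have h1 : 0 <= mu * (1 - z) by rewrite mulr_ge0 ?subr_ge0 // ltW.
have h2 : 0 <= mu * (1 - y) by rewrite mulr_ge0 ?subr_ge0 // ltW.
have h3 : 0 <= mu * y by rewrite mulr_ge0 // ltW.
have h4 : 0 <= mu * z by rewrite mulr_ge0 // ltW.
have e : (1 + mu) * ((y - z) / 2) = (y - z) / 2 + (mu * y - mu * z) / 2 by field.
by rewrite e; rewrite mulrBr mulr1 in h1; rewrite mulrBr mulr1 in h2; split; lra.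
Qed.

End PairForm.

(** * Maximizers of the pair form over pairs of distributions *)

Section Maximum.
Variables (R : realType) (b d : nat).
Hypothesis d1 : (1 < d)%N.
Local Open Scope classical_set_scope.

(** Both distributions are stored in one row vector, [p] in the left half and [q] in the right, so
    that compactness of boxes applies. *)
Let pv (v : 'rV[R]_(b + b)) (a : 'I_b) : R := v 0 (lshift b a).
Let qv (v : 'rV[R]_(b + b)) (a : 'I_b) : R := v 0 (rshift b a).
Let lv v := [seq (pv v a, qv v a) | a <- enum 'I_b].
Let sq (v : 'rV[R]_(b + b)) : R := \sum_i v 0 i ^+ 2.
Let simplex : set 'rV[R]_(b + b) :=
  [set v : 'rV[R]_(b + b) | (forall i, 0 <= v 0 i <= 1) /\
     (\sum_a pv v a = 1 /\ \sum_a qv v a = 1)].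

Lemma continuous_sum (T : topologicalType) (I : Type) (r : seq I) (f : I -> T -> R) :
  (forall i, continuous (f i)) -> continuous (fun v => \sum_(i <- r) f i v).
Proof.
move=> fc v; elim: r => [|i r IH].
  rewrite (_ : (fun _ => _) = cst 0); first exact: cvg_cst.
  by apply/funext => u; rewrite big_nil.
rewrite (_ : (fun _ => _) = (fun u => f i u + \sum_(j <- r) f j u)).
  by apply: cvgD; [exact: fc|exact: IH].
by apply/funext => u; rewrite big_cons.
Qed.

Lemma continuous_add (T : topologicalType) (f g : T -> R) :
  continuous f -> continuous g -> continuous (fun v => f v + g v).
Proof. by move=> fc gc v; apply: cvgD; [exact: fc|exact: gc]. Qed.

Lemma continuous_mul (T : topologicalType) (f g : T -> R) :
  continuous f -> continuous g -> continuous (fun v => f v * g v).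
Proof. by move=> fc gc v; apply: cvgM; [exact: fc|exact: gc]. Qed.

Lemma continuous_mulc (T : topologicalType) (k : R) (f : T -> R) :
  continuous f -> continuous (fun v => k * f v).
Proof. by move=> fc v; apply: cvgM; [exact: cvg_cst|exact: fc]. Qed.

Lemma continuous_esum_inj (T : topologicalType) (I : Type) (r : seq I)
    (f g : I -> T -> R) j : (forall i, continuous (f i)) ->
  continuous (fun v => esum_inj [seq (f i v, g i v) | i <- r] j).
Proof.
move=> fc; elim: r j => [|i r IH] [|j] v /=; try exact: cvg_cst.
apply: cvgD; first exact: IH.
by apply: cvgM; [apply: cvgM; [exact: cvg_cst|exact: fc]|exact: IH].
Qed.

Lemma continuous_mixed_inj (T : topologicalType) (I : Type) (r : seq I)
    (f g : I -> T -> R) j : (forall i, continuous (f i)) ->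
  (forall i, continuous (g i)) ->
  continuous (fun v => mixed_inj [seq (f i v, g i v) | i <- r] j).
Proof.
move=> fc gc; elim: r j => [|i r IH] j v /=; first exact: cvg_cst.
apply: cvgD; last by apply: cvgM; [exact: gc|exact: continuous_esum_inj].
apply: cvgD; first exact: IH.
case: j => [|j]; first exact: cvg_cst.
by apply: cvgM; [apply: cvgM; [exact: cvg_cst|exact: fc]|exact: IH].
Qed.

Let pv_continuous a : continuous (pv ^~ a).
Proof. exact: coord_continuous. Qed.
Let qv_continuous a : continuous (qv ^~ a).
Proof. exact: coord_continuous. Qed.

Lemma continuous_pair_form : continuous (fun v => pair_form b d (lv v)).
Proof.
apply: (continuous_add (continuous_mulc (continuous_add _ _)) (continuous_mulc _)).
  exact: continuous_mixed_inj.
  rewrite (_ : (fun _ => _) =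
     (fun v => mixed_inj [seq (qv v a, pv v a) | a <- enum 'I_b] d)).
    exact: continuous_mixed_inj.
  by apply/funext => u; rewrite -map_comp.
rewrite (_ : (fun _ => _) = (fun v => \sum_(a <- enum 'I_b) pv v a * qv v a)).
  apply: continuous_sum => a.
  exact: (continuous_mul (@pv_continuous a) (@qv_continuous a)).
by apply/funext => u; rewrite big_map.
Qed.

Lemma simplex_compact : compact simplex.
Proof.
have c01 : compact [set v : 'rV[R]_(b + b) | forall i, `[0%R, 1%R]%classic (v 0 i)].
  by apply: (@rV_compact R _ (fun=> `[0%R, 1%R]%classic)) => i; exact: segment_compact.
apply: (subclosed_compact _ c01).
  have cl (f : 'rV[R]_(b + b) -> 'I_b -> R) : (forall i, continuous (f ^~ i)) ->
      closed [set v : 'rV[R]_(b + b) | \sum_a f v a = 1].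
    move=> fc; apply: (@closed_comp _ _ (fun v => \sum_a f v a) [set x | x = 1]).
      by move=> v _; exact: continuous_sum.
    exact: closed_eq.
  have c1 : closed [set v : 'rV[R]_(b + b) | forall i, 0 <= v 0 i <= 1].
    rewrite [X in closed X](_ : _ =
       [set v : 'rV[R]_(b + b) | forall i, `[0%R, 1%R]%classic (v 0 i)]).
      by apply: compact_closed => //; exact: norm_hausdorff.
    by apply/seteqP; split => v /= h i; have := h i; rewrite in_itv.
  exact: (closedI c1 (closedI (cl _ pv_continuous) (cl _ qv_continuous))).
by move=> v [h _] i /=; rewrite in_itv /=.
Qed.

(* Among the maximizers of the pair form take one of least Euclidean norm. *)
Lemma best_point : simplex !=set0 -> exists2 v, simplex v &
  forall u, simplex u -> pair_form b d (lv u) <= pair_form b d (lv v) /\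
    (pair_form b d (lv u) = pair_form b d (lv v) -> sq v <= sq u).
Proof.
move=> s0; have wc (f : 'rV[R]_(b + b) -> R) (A : set 'rV[R]_(b + b)) :
    continuous f -> {within A, continuous f}.
  exact: continuous_subspaceT.
have [v0 /set_mem v0s v0max] :=
  compact_EVT_max s0 simplex_compact (wc _ _ continuous_pair_form).
pose B := simplex `&` [set v | pair_form b d (lv v) = pair_form b d (lv v0)].
have Bc : compact B.
  apply: (subclosed_compact _ simplex_compact); last by move=> v [].
  apply: closedI; first by apply: compact_closed simplex_compact; exact: norm_hausdorff.
  apply: (@closed_comp _ _ (fun v => pair_form b d (lv v))
    [set x | x = pair_form b d (lv v0)]); last exact: closed_eq.
  by move=> v _; exact: continuous_pair_form.
have sqc : continuous sq.
  apply: continuous_sum => i.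
  under eq_fun do rewrite expr2.
  by apply: continuous_mul; exact: coord_continuous.
have B0 : B !=set0 by exists v0.
have [v /set_mem [vs ve] vmin] := compact_EVT_min B0 Bc (wc _ _ sqc).
exists v => // u us; split; first by rewrite ve v0max // inE.
by move=> e; apply: vmin; rewrite inE; split => //=; rewrite e.
Qed.

Let upd v (a c : 'I_b) (x w : R) : 'rV[R]_(b + b) :=
  let sg := (pv v a + pv v c) / 2 in
  let tau := (qv v a + qv v c) / 2 in
  \row_(i < b + b) match fintype.split i with
          | inl e => if e == a then sg + x else if e == c then sg - x else pv v e
          | inr e => if e == a then tau + w else if e == c then tau - w else qv v e
          end.

Lemma pv_upd v a c x w e : pv (upd v a c x w) e =
  if e == a then (pv v a + pv v c) / 2 + x
  else if e == c then (pv v a + pv v c) / 2 - x else pv v e.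
Proof. by rewrite /pv /upd mxE (unsplitK (inl e)). Qed.

Lemma qv_upd v a c x w e : qv (upd v a c x w) e =
  if e == a then (qv v a + qv v c) / 2 + w
  else if e == c then (qv v a + qv v c) / 2 - w else qv v e.
Proof. by rewrite /qv /upd mxE (unsplitK (inr e)). Qed.

Lemma sq_split v : sq v = \sum_a (pv v a ^+ 2 + qv v a ^+ 2).
Proof. by rewrite /sq big_split_ord big_split. Qed.

Lemma sum_pair (f : 'I_b -> R) a c : a != c ->
  \sum_e f e = f a + f c + \sum_(e | (e != a) && (e != c)) f e.
Proof.
move=> ac; rewrite (bigD1 a) //= (bigD1 c) //= ?addrA //.
by rewrite eq_sym.
Qed.

Lemma upd_simplex v a c x w : a != c -> simplex v ->
  0 <= (pv v a + pv v c) / 2 + x -> 0 <= (pv v a + pv v c) / 2 - x ->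
  0 <= (qv v a + qv v c) / 2 + w -> 0 <= (qv v a + qv v c) / 2 - w ->
  simplex (upd v a c x w).
Proof.
move=> ac [v01 [sp sqq]] h1 h2 h3 h4.
have ca : (c == a) = false by rewrite eq_sym; exact/negbTE.
have e1 : \sum_e pv (upd v a c x w) e = 1.
  rewrite -sp (sum_pair _ ac) [RHS](sum_pair _ ac) !pv_upd eqxx ca eqxx.
  congr (_ + _); first by field.
  by apply: eq_bigr => e /andP[/negbTE ea /negbTE ec]; rewrite pv_upd ea ec.
have e2 : \sum_e qv (upd v a c x w) e = 1.
  rewrite -sqq (sum_pair _ ac) [RHS](sum_pair _ ac) !qv_upd eqxx ca eqxx.
  congr (_ + _); first by field.
  by apply: eq_bigr => e /andP[/negbTE ea /negbTE ec]; rewrite qv_upd ea ec.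
have le1 (f : 'I_b -> R) : (forall e, 0 <= f e) -> \sum_e f e = 1 ->
    forall e, 0 <= f e <= 1.
  move=> f0 <- e; rewrite f0 (bigD1 e) //= lerDl sumr_ge0 //.
have v0 i : 0 <= v 0 i by case/andP: (v01 i).
split=> // i; rewrite -(splitK i).
case: (fintype.split i) => e /=.
  apply: (le1 (pv (upd v a c x w))) => // {}e; rewrite pv_upd.
  by case: ifP => // _; case: ifP => // _; rewrite /pv.
apply: (le1 (qv (upd v a c x w))) => // {}e; rewrite qv_upd.
by case: ifP => // _; case: ifP => // _; rewrite /qv.
Qed.

Lemma pair_form_upd v a c : a != c -> simplex v ->
  exists C A B G : R, [/\ 0 <= A, 0 <= B & forall x w,
    pair_form b d (lv (upd v a c x w)) =
    C - A * x ^+ 2 - B * w ^+ 2 + G * (x * w)].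
Proof.
move=> ac [v01 _].
pose r := [seq (pv v e, qv v e) | e <- enum 'I_b & (e != a) && (e != c)].
have r0 : all (fun x => (0 <= x.1) && (0 <= x.2)) r.
  apply/allP => _ /mapP[e _ ->] /=.
  by case/andP: (v01 (lshift b e)) => -> _; case/andP: (v01 (rshift b e)) => -> _.
have [C [A [B [G [A0 B0 E]]]]] := pair_form_two b ((pv v a + pv v c) / 2)
  ((qv v a + qv v c) / 2) d1 r0.
exists C, A, B, G; split=> // x w; rewrite -E; apply: pair_form_perm.
have ca : (c == a) = false by rewrite eq_sym; exact/negbTE.
have en : perm_eq (enum 'I_b) [:: a, c & [seq e <- enum 'I_b | (e != a) && (e != c)]].
  apply: uniq_perm; first exact: enum_uniq.
    by rewrite /= !inE !mem_filter !eqxx (negbTE ac) !andbF filter_uniq // enum_uniq.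
  move=> e; rewrite mem_enum !inE mem_filter mem_enum inE andbT.
  by case: (e == a) => //; case: (e == c).
apply: perm_trans (perm_map _ en) _.
rewrite /lv /= !pv_upd !qv_upd !eqxx ca !perm_cons /r.
rewrite [X in perm_eq X _](_ : _ =
  [seq (pv v e, qv v e) | e <- enum 'I_b & (e != a) && (e != c)]) //.
apply/eq_in_map => e; rewrite mem_filter => /andP[/andP[/negbTE ea /negbTE ec] _].
by rewrite pv_upd qv_upd ea ec.
Qed.

(* Along a pair of coordinates with fixed sums the form is quadratic in the
   two half-differences. At the chosen maximizer they vanish, unless the
   quadratic part is positive; then one can still move outwards, unless one of
   the four entries is zero. *)
Lemma best_point_types v : simplex v ->
  (forall u, simplex u -> pair_form b d (lv u) <= pair_form b d (lv v) /\
    (pair_form b d (lv u) = pair_form b d (lv v) -> sq v <= sq u)) ->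
  forall a c, (pv v a == 0) = (pv v c == 0) -> (qv v a == 0) = (qv v c == 0) ->
  (pv v a, qv v a) = (pv v c, qv v c).
Proof.
move=> vs best a c; have [->//|ac] := eqVneq a c; move=> ta tb.
have ca : (c == a) = false by rewrite eq_sym; exact/negbTE.
have [v01 _] := vs.
pose x := (pv v a - pv v c) / 2; pose w := (qv v a - qv v c) / 2.
have pa : (pv v a + pv v c) / 2 + x = pv v a by rewrite /x; field.
have pc : (pv v a + pv v c) / 2 - x = pv v c by rewrite /x; field.
have qa : (qv v a + qv v c) / 2 + w = qv v a by rewrite /w; field.
have qc : (qv v a + qv v c) / 2 - w = qv v c by rewrite /w; field.
have [pa0 pa1] : 0 <= pv v a /\ pv v a <= 1 by apply/andP/v01.
have [pc0 pc1] : 0 <= pv v c /\ pv v c <= 1 by apply/andP/v01.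
have [qa0 qa1] : 0 <= qv v a /\ qv v a <= 1 by apply/andP/v01.
have [qc0 qc1] : 0 <= qv v c /\ qv v c <= 1 by apply/andP/v01.
have [C [A [B [G [A0 B0 E]]]]] := pair_form_upd ac vs.
have vE : lv (upd v a c x w) = lv v.
  apply: eq_map => e; rewrite pv_upd qv_upd pa pc qa qc.
  by case: eqP => [->|_]; rewrite ?eqxx //; case: eqP => [->|].
pose Q (y z : R) := - A * y ^+ 2 - B * z ^+ 2 + G * (y * z).
have EQ y z : pair_form b d (lv (upd v a c y z)) = C + Q y z.
  by rewrite E /Q; ring.
have vQ : pair_form b d (lv v) = C + Q x w by rewrite -vE EQ.
have [/andP[/eqP x0 /eqP w0]|xw0] := boolP ((x == 0) && (w == 0)).
  by congr (_, _); [move: x0; rewrite /x|move: w0; rewrite /w]; lra.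
(* If [Q x w <= 0], equalizing both coordinates would not lower the form but would strictly decrease
   the norm. *)
have Qpos : 0 < Q x w.
  rewrite ltNge; apply/negP => Qle.
  have us : simplex (upd v a c 0 0).
    by apply: upd_simplex => //; rewrite ?addr0 ?subr0 divr_ge0 // addr_ge0.
  have [le1 eqle] := best _ us.
  have Q0 : Q 0 0 = 0 by rewrite /Q; ring.
  have := eqle _; rewrite EQ vQ Q0 addr0 => {eqle}H.
  have Qe : Q x w = 0.
    by apply/le_anti; rewrite Qle; move: le1; rewrite EQ vQ Q0 addr0 -{1}[C]addr0 lerD2l.
  have := H _; rewrite Qe addr0 => /(_ erefl); apply/negP; rewrite -ltNge.
  rewrite !sq_split (sum_pair _ ac) [ltRHS](sum_pair _ ac) !pv_upd !qv_upd eqxx ca eqxx.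
  rewrite !addr0 !subr0 (eq_bigr (fun e => pv v e ^+ 2 + qv v e ^+ 2)) => [|e]; last first.
    by case/andP=> /negbTE ea /negbTE ec; rewrite pv_upd qv_upd ea ec.
  rewrite ltrD2r -subr_gt0.
  rewrite [ltRHS](_ : _ = 2 * (x ^+ 2 + w ^+ 2)); last by rewrite /x /w; field.
  rewrite pmulr_rgt0 // lt_neqAle addr_ge0 ?sqr_ge0 // andbT eq_sym.
  by rewrite paddr_eq0 ?sqr_ge0 // !sqrf_eq0.
(* If one half-difference vanishes, only a nonpositive square remains in [Q]. *)
have x0 : x != 0.
  apply: contraTneq Qpos => ->; rewrite /Q -leNgt expr0n mulr0 mul0r mulr0 addr0 add0r oppr_le0.
  by rewrite mulr_ge0 ?sqr_ge0.
have w0 : w != 0.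
  apply: contraTneq Qpos => ->; rewrite /Q -leNgt expr0n !mulr0 addr0 subr0 mulNr oppr_le0.
  by rewrite mulr_ge0 ?sqr_ge0.
(* A zero entry would force the other one to be zero too, by the equal zero patterns, and so a zero
   half-difference. *)
have pos1 : 0 < pv v a.
  rewrite lt_neqAle pa0 andbT eq_sym; apply: contra x0 => /eqP e.
  by move: ta; rewrite /x e eqxx => /esym/eqP ->; rewrite subrr mul0r.
have pos2 : 0 < pv v c.
  by rewrite lt_neqAle pc0 andbT eq_sym -ta gt_eqF.
have pos3 : 0 < qv v a.
  rewrite lt_neqAle qa0 andbT eq_sym; apply: contra w0 => /eqP e.
  by move: tb; rewrite /w e eqxx => /esym/eqP ->; rewrite subrr mul0r.
have pos4 : 0 < qv v c.
  by rewrite lt_neqAle qc0 andbT eq_sym -tb gt_eqF.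
pose mu := Num.min (Num.min (pv v a) (pv v c)) (Num.min (qv v a) (qv v c)).
have mu0 : 0 < mu by rewrite !lt_min pos1 pos2 pos3.
have [m1 m2] : mu <= pv v a /\ mu <= pv v c by split; rewrite /mu !ge_min lexx ?orbT.
have [m3 m4] : mu <= qv v a /\ mu <= qv v c by split; rewrite /mu !ge_min lexx ?orbT.
have us : simplex (upd v a c ((1 + mu) * x) ((1 + mu) * w)).
  have [h1 h2] := scaled_halves pa0 pc0 pc1 pa1 m1 m2 mu0.
  have [h3 h4] := scaled_halves qa0 qc0 qc1 qa1 m3 m4 mu0.
  exact: upd_simplex.
have [+ _] := best _ us; rewrite EQ vQ lerD2l leNgt => /negP; case.
(* [Q] is homogeneous of degree 2, so the outward move strictly increases a positive value. *)
have -> : Q ((1 + mu) * x) ((1 + mu) * w) = (1 + mu) ^+ 2 * Q x w by rewrite /Q; ring.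
by rewrite -[ltLHS]mul1r ltr_pM2r // expr_gt1 ?addr_ge0 ?(ltW mu0) // ltrDl.
Qed.

Lemma simplex_pair_form_le fuel (v : 'rV[R]_(b + b)) :
  search_ok fuel b d -> simplex v -> pair_form b d (lv v) <= pair_bound R b d.
Proof.
move=> ok vs; have [u us best] := best_point (ex_intro _ v vs).
apply: le_trans (best v vs).1 _.
have same := best_point_types us best.
have l0 : all (fun x => (0 <= x.1) && (0 <= x.2)) (lv u).
  apply/allP => _ /mapP[a _ ->] /=; have [u01 _] := us.
  by case/andP: (u01 (lshift b a)) => -> _; case/andP: (u01 (rshift b a)) => -> _.
have [|P [Q [p [q [i [j [l [m [[P0 Q0 p0 q0] pe]]]]]]]]] := pattern_of_types l0.
  by move=> _ _ /mapP[a _ ->] /mapP[c _ ->] /= ta tb; exact: same.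
rewrite (pair_form_perm _ _ pe); apply: (pair_form_pattern ok) => //.
- exact: ltnW.
- move/perm_size: pe; rewrite size_map size_enum_ord => ->.
  by rewrite !size_cat !size_nseq !addnA.
- have [_ [e _]] := us.
  transitivity (\sum_(x <- lv u) x.1); last by rewrite big_map big_enum e.
  rewrite (perm_big _ pe) !big_cat !big_nseq /= !iter_addr_0 !mul0rn !addr0.
  by rewrite addrC !mulr_natl.
- have [_ [_ e]] := us.
  transitivity (\sum_(x <- lv u) x.2); last by rewrite big_map big_enum e.
  rewrite (perm_big _ pe) !big_cat !big_nseq /= !iter_addr_0 !mul0rn !addr0 add0r.
  by rewrite addrC !mulr_natl.
Qed.

Lemma pair_form_le fuel (p q : 'I_b -> R) : search_ok fuel b d ->
  (forall a, 0 <= p a) -> (forall a, 0 <= q a) ->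
  \sum_a p a = 1 -> \sum_a q a = 1 ->
  pair_form b d [seq (p a, q a) | a <- enum 'I_b] <= pair_bound R b d.
Proof.
move=> ok p0 q0 sp sqq.
pose v : 'rV[R]_(b + b) := \row_(i < b + b)
  match fintype.split i with inl a => p a | inr a => q a end.
have vp a : pv v a = p a by rewrite /pv mxE (unsplitK (inl a)).
have vq a : qv v a = q a by rewrite /qv mxE (unsplitK (inr a)).
have le1 (f : 'I_b -> R) : (forall e, 0 <= f e) -> \sum_e f e = 1 ->
    forall e, 0 <= f e <= 1.
  by move=> f0 <- e; rewrite f0 (bigD1 e) //= lerDl sumr_ge0.
have := simplex_pair_form_le ok (_ : simplex v).
rewrite /lv (eq_map (g := fun a => (p a, q a))) => [|a]; last by rewrite vp vq.
apply; split; first by move=> i; rewrite mxE; case: fintype.split => a; exact: le1.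
by split; [rewrite -sp|rewrite -sqq]; apply: eq_bigr.
Qed.
End Maximum.

(** * Independent draws *)

Section Iid.
Variable R : realFieldType.

Section Basic.
Variables (T : finType) (h : T -> R).

(* Expectation of [G] over [d] independent draws with (sub)distribution [h]. *)
Fixpoint iid (d : nat) (G : seq T -> R) : R :=
  if d is d'.+1 then \sum_w h w * iid d' (fun s => G (w :: s)) else G [::].

Lemma iidS d G : iid d.+1 G = \sum_w h w * iid d (fun s => G (w :: s)).
Proof. by []. Qed.

Lemma eq_iid d G G' : G =1 G' -> iid d G = iid d G'.
Proof.
elim: d G G' => [|d IH] G G' e /=; first exact: e.
by apply: eq_bigr => w _; congr (_ * _); apply: IH => s; exact: e.
Qed.

Lemma iidZ d c G : iid d (fun s => c * G s) = c * iid d G.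
Proof.
elim: d G => [|d IH] G //=; rewrite mulr_sumr; apply: eq_bigr => w _.
by rewrite IH mulrCA.
Qed.

Lemma iid_sum d (I : Type) (r : seq I) (P : pred I) (F : I -> seq T -> R) :
  iid d (fun s => \sum_(i <- r | P i) F i s) = \sum_(i <- r | P i) iid d (F i).
Proof.
elim: d F => [|d IH] F //=; rewrite exchange_big /=; apply: eq_bigr => w _.
by rewrite IH mulr_sumr.
Qed.

Lemma iidD d G G' : iid d (fun s => G s + G' s) = iid d G + iid d G'.
Proof.
elim: d G G' => [|d IH] G G' //=; rewrite -big_split; apply: eq_bigr => w _ /=.
by rewrite IH mulrDr.
Qed.

Hypothesis h0 : forall w, 0 <= h w.

Lemma iid_le d G G' :
  (forall s, size s = d -> all (fun w => h w != 0) s -> G s <= G' s) ->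
  iid d G <= iid d G'.
Proof.
elim: d G G' => [|d IH] G G' le /=; first exact: le.
apply: ler_sum => w _; have [->|hw] := eqVneq (h w) 0; first by rewrite !mul0r.
by rewrite ler_wpM2l //; apply: IH => s ss hs; apply: le; rewrite /= ?ss ?hw.
Qed.

Lemma iid_ge0 d G : (forall s, 0 <= G s) -> 0 <= iid d G.
Proof.
elim: d G => [|d IH] G G0 /=; first exact: G0.
by apply: sumr_ge0 => w _; rewrite mulr_ge0 // IH.
Qed.

Hypothesis h1 : \sum_w h w = 1.

Lemma iid_const d c : iid d (fun=> c) = c.
Proof.
by elim: d => [|d IH] //=; rewrite IH -mulr_suml h1 mul1r.
Qed.

(** Union bound over pairs of draws, each of which coincides with probability at most [e]. *)
Lemma iid_uniq_ge e d : (forall w, h w <= e) ->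
  1 - (d ^ 2)%:R * e <= iid d (fun s => (uniq s)%:R).
Proof.
move=> he; have [w0 _] : exists w : T, true.
  case: (pickP (@predT T)) h1 => [w _ _|n]; first by exists w.
  by rewrite big_pred0 // => /eqP; rewrite eq_sym oner_eq0.
have e0 : 0 <= e := le_trans (h0 w0) (he w0).
elim: d => [|d IH] /=; first by rewrite mul0r subr0.
(* The added draw hits one of the other [d] with probability at most [d * e]. *)
have step : iid d (fun s => (uniq s)%:R) - d%:R * e <=
    \sum_w h w * iid d (fun s => (uniq (w :: s))%:R).
  have -> : \sum_w h w * iid d (fun s => (uniq (w :: s))%:R) =
            iid d (fun s => \sum_w h w * (uniq (w :: s))%:R).
    by rewrite iid_sum; apply: eq_bigr => w _; rewrite iidZ.
  rewrite -[d%:R * e](iid_const d) -mulN1r -iidZ -iidD; apply: iid_le => s ss _.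
  have -> : (uniq s)%:R + -1 * (d%:R * e) = \sum_w h w * (uniq s)%:R - d%:R * e.
    by rewrite -mulr_suml h1 mul1r mulN1r.
  rewrite lerBlDr -lerBlDl -sumrB.
  apply: (@le_trans _ _ (\sum_(w in s) e)).
    rewrite [leRHS]big_mkcond; apply: ler_sum => w _ /=.
    case: (w \in s) => /=; last by rewrite subrr.
    by rewrite mulr0 subr0; case: (uniq s); rewrite ?mulr1 ?mulr0.
  by rewrite sumr_const -[e *+ _]mulr_natl ler_wpM2r // ler_nat -ss card_size.
apply: le_trans step; rewrite lerBrDr; apply: le_trans IH.
rewrite -addrA lerD2l addrC lerBlDr addrC -lerBlDr opprK -mulrDl ler_wpM2r //.
by rewrite -natrD ler_nat; nia.
Qed.

End Basic.

Lemma iid_push (T A : finType) (h : T -> R) (f : T -> A) d G :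
  iid h d (fun s => G (map f s)) =
  iid (fun a => \sum_(w | f w == a) h w) d G.
Proof.
elim: d G => [|d IH] G //=; rewrite (partition_big f xpredT) //=.
apply: eq_bigr => a _; rewrite mulr_suml; apply: eq_bigr => w /eqP <-.
by rewrite (IH (fun s => G (f w :: s))).
Qed.

Lemma iid_esum_inj (A : finType) (p q : A -> R) (D : seq A) d : uniq D ->
  iid p d (fun s => (uniq s && all (mem D) s)%:R) =
  esum_inj [seq (p a, q a) | a <- D] d.
Proof.
elim: d D => [|d IH] D uD; first by rewrite esum_inj0.
rewrite iidS (esum_inj_rem _ _ _ uD) (big_uniq _ uD) [RHS]big_mkcond; apply: eq_bigr => a _ /=.
case: ifPn => aD; last first.
  rewrite (@eq_iid _ _ _ _ (fun=> 0 * 0)) ?iidZ ?mul0r ?mulr0 // => s.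
  by rewrite /= andbF ?mul0r.
rewrite -IH ?rem_uniq //; congr (_ * _); apply: eq_iid => s; congr (nat_of_bool _)%:R.
rewrite /= -andbA andbCA; congr (_ && _).
elim: s => [|x s IHs] //=; rewrite -IHs mem_rem_uniq // !inE negb_or eq_sym.
by case: (x == a); case: (x \in D); rewrite /= ?andbF.
Qed.

(** Identifies [mixed_inj] with the probability [T(p, q)]. *)
Lemma iid_mixed_inj (A : finType) (p q : A -> R) d :
  \sum_c q c * iid p d (fun s => (uniq (c :: s))%:R) =
  mixed_inj [seq (p a, q a) | a <- enum A] d.
Proof.
rewrite mixed_inj_rem ?enum_uniq // big_enum; apply: eq_bigr => c _.
rewrite -iid_esum_inj ?rem_uniq ?enum_uniq //; congr (_ * _); apply: eq_iid => s.
congr (nat_of_bool _)%:R; rewrite /= andbC; congr (_ && _).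
elim: s => [|x s IHs] //=; rewrite inE negb_or IHs mem_rem_uniq ?enum_uniq //.
by rewrite !inE mem_enum andbT eq_sym.
Qed.

End Iid.

(** * Averaging over a random subcode *)

Section Average.
Variables (R : realType) (b d fuel : nat).
Hypotheses (d1 : (1 < d)%N) (b1 : (1 < b)%N) (ok : search_ok fuel b d).

(* Average the pair inequality over two independent copies of the random
   distribution [p s]: the mean of [<p s, p t>] is [|q|^2 >= 1 / b]. *)
Lemma average_mixed_inj (S : finType) (lam : S -> R) (p : S -> 'I_b -> R)
    (q : 'I_b -> R) :
  (forall s, 0 <= lam s) -> 0 < \sum_s lam s ->
  (forall s a, 0 <= p s a) ->
  (forall s, lam s != 0 -> \sum_a p s a = 1) ->
  (forall a, (\sum_s lam s) * q a = \sum_s lam s * p s a) ->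
  b%:R ^+ d.+1 * \sum_s lam s * mixed_inj [seq (p s a, q a) | a <- enum 'I_b] d
  <= (\sum_s lam s) * (b ^_ d.+1)%:R.
Proof.
set W := \sum_s lam s => lam0 W0 p0 p1 qE.
pose Mx s t := mixed_inj [seq (p s a, p t a) | a <- enum 'I_b] d.
pose ip s t := \sum_a p s a * p t a.
set X := \sum_s lam s * _.
(* [mixed_inj] is linear in its second distribution, and [q] is the average of the [p t]. *)
have XE : W * X = \sum_s \sum_t lam s * lam t * Mx s t.
  rewrite mulr_sumr; apply: eq_bigr => s _; rewrite mulrCA.
  rewrite mixed_inj_rem ?enum_uniq // mulr_sumr.
  under eq_bigr => a _ do rewrite mulrA qE mulr_suml.
  rewrite exchange_big mulr_sumr; apply: eq_bigr => t _ /=.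
  rewrite /Mx mixed_inj_rem ?enum_uniq // -mulrA; congr (_ * _); rewrite mulr_sumr.
  apply: eq_bigr => a _; rewrite mulrA; congr (_ * _).
  elim: d (rem a (enum 'I_b)) => [|e IH] r; first by rewrite !esum_inj0.
  by elim: r => [|x r IHr] //=; rewrite IHr IH.
have IE : W ^+ 2 * \sum_a q a ^+ 2 = \sum_s \sum_t lam s * lam t * ip s t.
  rewrite mulr_sumr; under eq_bigr => a _ do rewrite -exprMn qE expr2 mulr_suml.
  rewrite exchange_big; apply: eq_bigr => s _ /=.
  under eq_bigr => a _ do rewrite mulr_sumr.
  rewrite exchange_big; apply: eq_bigr => t _ /=; rewrite mulr_sumr.
  by apply: eq_bigr => a _; ring.
have q1 : \sum_a q a = 1.
  apply: (mulfI (lt0r_neq0 W0)); rewrite mulr_sumr mulr1.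
  under eq_bigr => a _ do rewrite qE.
  rewrite exchange_big /=; apply: eq_bigr => s _; rewrite -mulr_sumr.
  by have [->|/p1 ->] := eqVneq (lam s) 0; rewrite ?mul0r ?mulr1.
have bR : 0 < b%:R :> R by rewrite ltr0n ltnW.
(* Cauchy-Schwarz against the uniform distribution, by expanding squares of [b * q a - 1]. *)
have qsq : 1 <= b%:R * \sum_a q a ^+ 2.
  have : 0 <= \sum_a (b%:R * q a - 1) ^+ 2 by apply: sumr_ge0 => a _; exact: sqr_ge0.
  rewrite (eq_bigr (fun a => b%:R ^+ 2 * q a ^+ 2 + -2 * b%:R * q a + 1)) => [|a _]; last ring.
  rewrite !big_split /= sumr_const card_ord -!mulr_sumr q1.
  rewrite [leRHS](_ : _ = b%:R * (b%:R * \sum_a q a ^+ 2 - 1)); last ring.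
  by rewrite pmulr_rge0 // subr_ge0.
have key : \sum_s \sum_t lam s * lam t * ((25 * b.-1)%:R * b%:R ^+ d.+1 * (Mx s t + Mx t s)
     + (49 * b)%:R * (b ^_ d.+1)%:R * ip s t) <= \sum_s \sum_t lam s * lam t * pair_bound R b d.
  apply: ler_sum => s _; apply: ler_sum => t _.
  have [->|ls] := eqVneq (lam s) 0; first by rewrite !mul0r.
  have [->|lt] := eqVneq (lam t) 0; first by rewrite mulr0 !mul0r.
  rewrite ler_wpM2l ?mulr_ge0 //.
  have := pair_form_le d1 ok (p0 s) (p0 t) (p1 s ls) (p1 t lt).
  by rewrite /pair_form -[map (@swap R) _]map_comp big_map big_enum.
have WW : \sum_s \sum_t lam s * lam t = W ^+ 2.
  by rewrite expr2 /W big_distrl; apply: eq_bigr => s _; rewrite big_distrr.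
have lhsE : \sum_s \sum_t lam s * lam t * ((25 * b.-1)%:R * b%:R ^+ d.+1 * (Mx s t + Mx t s)
     + (49 * b)%:R * (b ^_ d.+1)%:R * ip s t) =
   (25 * b.-1)%:R * b%:R ^+ d.+1 * (2 * (W * X))
     + (49 * b)%:R * (b ^_ d.+1)%:R * (W ^+ 2 * \sum_a q a ^+ 2).
  have XE' : W * X = \sum_s \sum_t lam s * lam t * Mx t s.
    rewrite XE exchange_big; apply: eq_bigr => s _; apply: eq_bigr => t _ /=.
    by rewrite [lam t * _]mulrC.
  rewrite mulr2n mulrDl mul1r {1}XE XE' IE -big_split !mulr_sumr -big_split.
  apply: eq_bigr => s _ /=; rewrite -big_split !mulr_sumr -big_split.
  by apply: eq_bigr => t _ /=; ring.
move: key; rewrite lhsE (_ : \sum_s \sum_t _ = W ^+ 2 * pair_bound R b d); last first.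
  rewrite -WW mulr_suml; apply: eq_bigr => s _; rewrite mulr_suml.
  by apply: eq_bigr.
rewrite /pair_bound => key.
have F0 : 0 <= (49%:R * (b ^_ d.+1)%:R) * W ^+ 2 :> R.
  by rewrite mulr_ge0 ?sqr_ge0 // mulr_ge0 ?ler0n.
have := ler_wpM2l F0 qsq => h2.
have b10 : 0 < (b.-1)%:R :> R by rewrite ltr0n -ltnS prednK // ltnW.
rewrite -(ler_pM2l (_ : 0 < 50 * b.-1%:R * W)); last by rewrite mulr_gt0 // mulr_gt0.
(* The summand 49 is cancelled by the inner product term, which by [qsq] contributes at least as
   much. *)
have b50 : (50 * b).-1%:R = 50 * b.-1%:R + 49 :> R.
  by rewrite -natrM -natrD; congr _%:R; case: (b) b1 => // n _; lia.
move: key; rewrite b50 (natrM _ 25) (natrM _ 49) => key.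
clear ok; move: key h2; set Y := b%:R ^+ d.+1; set Z := \sum_a _; set F := (b ^_ _)%:R.
clearbody X Y Z F W; move=> key h2; lra.
Qed.
End Average.

(** * The combinatorial inequality *)

Section Hansel.
Variable R : realType.

(** Jensen's inequality for the exponential, proved with its tangent at the mean [a] of
    [ln m * e v]. *)
Lemma entropy_bound (T : finType) (V : {set T}) (m : nat) (e : T -> nat) :
  (0 < m)%N -> \sum_(v in V) (m%:R ^- e v : R) <= 1 ->
  #|V|%:R * ln (#|V|%:R : R) <= ln m%:R * \sum_(v in V) (e v)%:R.
Proof.
move=> m0 le1; have m1 : 1 <= m%:R :> R by rewrite ler1n.
have lm0 : 0 <= ln m%:R :> R by rewrite ln_ge0.
have [V0|V0] := posnP #|V|.
  by rewrite V0 mul0r mulr_ge0 // sumr_ge0.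
have K0 : 0 < #|V|%:R :> R by rewrite ltr0n.
set S := \sum_(v in V) _; have [a aE] : exists a, a = ln m%:R * S / #|V|%:R by eexists.
suff : ln (#|V|%:R : R) <= a.
  by move/(ler_wpM2l (ltW K0)); rewrite aE mulrCA divff ?mulr1 // gt_eqF.
suff : #|V|%:R * expR (- a) <= 1.
  by rewrite expRN ler_pdivrMr ?expR_gt0 // mul1r => h; rewrite -ler_expR lnK.
apply: le_trans le1.
(* The deviations from the mean sum to zero. *)
rewrite (_ : _ * _ = \sum_(v in V) expR (- a) * (1 + (a - ln m%:R * (e v)%:R))); last first.
  rewrite -mulr_sumr mulrC; congr (_ * _).
  rewrite big_split sumrB /= !sumr_const -[\sum_(i in V) ln _ * _]mulr_sumr -/S.
  by rewrite -[a *+ _]mulr_natl aE mulrCA divff ?gt_eqF // mulr1 subrr addr0.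
apply: ler_sum => v _.
have -> : m%:R ^- e v = expR (- a) * expR (a - ln m%:R * (e v)%:R) :> R.
  rewrite -expRD addrA addNr add0r expRN; congr (_^-1).
  by rewrite mulrC expRM_natl lnK // posrE ltr0n.
by rewrite ler_wpM2l ?expR_ge0 // expR_ge1Dx.
Qed.

Variables (b n d : nat) (C : {set word b n}).
Hypotheses (db : (d < b)%N) (hashC : is_hash_code d.+2 C).

Definition symbols (x : seq (word b n)) (i : 'I_n) : seq 'I_b :=
  [seq w i | w : word b n <- x].

Lemma hash_separates (x : seq (word b n)) (v w : word b n) :
  size x = d -> uniq [:: v, w & x] -> {subset [:: v, w & x] <= C} ->
  exists i, uniq [:: v i, w i & symbols x i].
Proof.
move=> sx ux sub; have /forallP/(_ [set:: [:: v, w & x]]) := hashC.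
rewrite cardsE (card_uniqP ux) /= sx eqxx andbT.
have -> : [set:: [:: v, w & x]] \subset C.
  by apply/fintype.subsetP => u; rewrite inE; exact: sub.
move=> /existsP[i h]; exists i.
change (uniq (map (fun u : word b n => u i) [:: v, w & x])).
rewrite map_inj_in_uniq // => y z yx zx /eqP yz; apply/eqP.
have /forall_inP/(_ y) := h; rewrite inE => /(_ yx)/forall_inP/(_ z).
by rewrite inE => /(_ zx)/implyP; apply.
Qed.

(* A colour outside the [d] symbols is drawn independently in every
   coordinate; a word survives if its own symbol is drawn wherever it is
   separated from the [d] words, and two words cannot both survive. *)
Lemma hansel (x : seq (word b n)) : size x = d -> uniq x -> {subset x <= C} ->
  \sum_(v in C :\: [set:: x])
     ((b - d)%:R ^- #|[set i | uniq (v i :: symbols x i)]| : R) <= 1.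
Proof.
move=> sx ux xC; pose good v i := uniq (v i :: symbols x i).
(* [family F] consists of all colourings avoiding the symbols of [x]; [family (Z v)] of those in
   which [v] survives. *)
pose F i : {pred 'I_b} := [pred a | a \notin symbols x i].
pose Z (v : word b n) i : {pred 'I_b} := [pred a | if good v i then a == v i else F i a].
pose V := C :\: [set:: x].
have cE i : (#|symbols x i| + #|F i| = b)%N.
  rewrite -[RHS]card_ord -(cardC (mem (symbols x i))); congr (_ + _)%N.
have cF i : (0 < #|F i|)%N.
  rewrite -(ltn_add2l #|symbols x i|) addn0 cE (leq_ltn_trans _ db) //.
  by rewrite (leq_trans (card_size _)) // size_map sx.
have cFu i : uniq (symbols x i) -> #|F i| = (b - d)%N.
  move=> u; have := cE i; rewrite (card_uniqP u) size_map sx => e.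
  by apply: (@addnI d); rewrite subnKC // ltnW.
have cZ v : #|family (Z v)| = (\prod_i (if good v i then 1 else #|F i|))%N.
  rewrite card_family foldrE big_map big_enum; apply: eq_bigr => i _.
  rewrite /Z; case: (good v i); first by rewrite (fintype.eq_card (B := pred1 (v i))) ?card1.
  by apply: fintype.eq_card => a.
have cFF : #|family F| = (\prod_i #|F i|)%N.
  by rewrite card_family foldrE big_map big_enum.
have ZF v c : c \in family (Z v) -> c \in family F.
  move/familyP => h; apply/familyP => i; have := h i; rewrite !inE.
  case: ifP => // g /eqP ->; by case/andP: g.
(* At a coordinate separating [v], [w] and [x], two survivors would both carry the drawn colour. *)
have disj c : (#|[set v in V | c \in family (Z v)]| <= 1)%N.
  apply/card_le1_eqP => v w; rewrite !inE.
  case/andP=> /andP[vx vC] vZ /andP[/andP[wx wC] wZ]; apply/eqP/negPn/negP => vw.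
  have vwC : {subset [:: v, w & x] <= C}.
    by move=> u; rewrite !inE => /or3P[/eqP->|/eqP->|/xC].
  have vwu : uniq [:: v, w & x].
    by rewrite /= ux andbT wx inE negb_or eq_sym vw vx.
  have [i] := hash_separates sx vwu vwC.
  rewrite /= inE negb_or => /andP[/andP[vwi vi] /andP[wi ui]].
  have := familyP vZ i; have := familyP wZ i; rewrite !inE /good /= vi wi ui.
  by move=> /eqP -> /eqP e; rewrite e eqxx in vwi.
have cZF v : (#|family (Z v)| = \sum_(c in family F) if c \in family (Z v) then 1 else 0)%N.
  rewrite -sum1_card -big_mkcondr; apply: eq_bigl => c.
  by have [/ZF->|] := boolP (c \in family (Z v)); rewrite ?andbF.
have total : (\sum_(v in V) #|family (Z v)| <= #|family F|)%N.
  under eq_bigr => v _ do rewrite cZF.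
  rewrite exchange_big -[leqRHS]sum1_card; apply: leq_sum => c _ /=.
  by rewrite -big_mkcondr sum1dep_card disj.
have P0 : 0 < #|family F|%:R :> R by rewrite ltr0n cFF prodn_gt0.
rewrite -(ler_pM2r P0) mul1r mulr_suml;
  apply: le_trans (_ : _ <= (\sum_(v in V) #|family (Z v)|)%N%:R) _;
  last by rewrite ler_nat.
(* At a good coordinate [v] fixes one of [b - d] colours, elsewhere it restricts nothing. *)
rewrite natr_sum; apply: ler_sum => v _; rewrite cZ cFF !natr_prod.
have m0 : (b - d)%:R != 0 :> R by rewrite pnatr_eq0 -lt0n subn_gt0.
rewrite -exprVn -prodr_const big_mkcond -big_split /= le_eqVlt; apply/orP; left.
apply/eqP/eq_bigr => i _; have -> : (i \in [set i | uniq (v i :: symbols x i)]) = good v i.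
  by rewrite inE.
case g: (good v i); last by rewrite mul1r.
by rewrite cFu ?mulVf //; case/andP: g.
Qed.
End Hansel.

Section Coding.
Variables (R : realType) (b0 n d fuel : nat) (C : {set word b0.+1 n}).
Let b := b0.+1.
Hypotheses (d1 : (1 < d)%N) (db : (d < b)%N).
Hypotheses (hashC : is_hash_code d.+2 C) (ok : search_ok fuel b d).

(** [hansel] feeds [entropy_bound] with [m = b - d]; extending the sum to all of [C] adds
    nonnegative terms. *)
Lemma hansel_ln (x : seq (word b n)) : size x = d -> uniq x -> {subset x <= C} ->
  (#|C| - d)%:R * ln (#|C| - d)%:R <=
  ln (b - d)%:R * \sum_(v in C) \sum_i (uniq (v i :: symbols x i))%:R :> R.
Proof.
move=> sx ux xC.
have cV : #|C :\: [set:: x]| = (#|C| - d)%N.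
  rewrite cardsD (finset.setIidPr _); last by apply/fintype.subsetP => u; rewrite inE => /xC.
  by rewrite cardsE (card_uniqP ux) sx.
have bd0 : (0 < b - d)%N by rewrite subn_gt0.
rewrite -cV; apply: le_trans (entropy_bound bd0 (hansel R db hashC sx ux xC)) _.
rewrite ler_wpM2l ?ln_ge0 ?ler1n ?subn_gt0 //.
rewrite [leRHS](bigID (fun v => v \in [set:: x])) /= addrC.
rewrite (eq_bigl (fun v => (v \in C) && (v \notin [set:: x]))) => [|v]; last first.
  by rewrite !inE andbC.
rewrite -[leLHS]addr0 lerD //; last by apply: sumr_ge0 => v _; apply: sumr_ge0.
apply: ler_sum => v _; rewrite -sum1dep_card natr_sum [leLHS]big_mkcond.
by apply: ler_sum => i _; case: ifP.
Qed.

(* Only the first [l] coordinates of [s] matter: there [w] has to lie in the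
   cyclic window of [d.-1] symbols starting at [s i]. *)
Definition window (l : nat) (s : word b n) : {set word b n} :=
  [set w in C | [forall i : 'I_n, (i < l)%N ==> (nat_of_ord (w i - s i)%R < d.-1)%N]].

(** Each early coordinate admits [d.-1] window starts and each late one all [b]. The count is the
    same for every word, which makes the subcodes average to [C]. *)
Lemma card_windows l (w : word b n) : (l <= n)%N -> w \in C ->
  #|[set s | w \in window l s]| = (d.-1 ^ l * b ^ (n - l))%N.
Proof.
move=> ln wC.
pose F (i : 'I_n) : {pred 'I_b} :=
  [pred a | (i < l)%N ==> (nat_of_ord (w i - a)%R < d.-1)%N].
have -> : #|[set s | w \in window l s]| = #|family F|.
  apply: fintype.eq_card => s; rewrite !finset.in_set wC /=.
  by apply/forallP/familyP => h i; have := h i; rewrite inE.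
have cF i : #|F i| = if (i < l)%N then d.-1 else b.
  rewrite /F; case: (i < l)%N; last first.
    by rewrite (fintype.eq_card (B := predT)) ?card_ord // => a.
  have inj : injective (fun a : 'I_b => w i - a) by move=> a c /addrI /oppr_inj.
  have -> : #|[pred a : 'I_b | true ==> (nat_of_ord (w i - a)%R < d.-1)%N]| =
      #|[pred a : 'I_b | (a < d.-1)%N]|.
    rewrite -(fintype.card_image inj); apply: fintype.eq_card => a.
    apply/fintype.imageP/idP => [[c hc ->]//|ha].
    exists (w i - a); last by rewrite subKr.
    by rewrite unfold_in subKr.
  have db1 : (d.-1 <= b)%N by apply: leq_trans (leq_pred _) (ltnW db).
  rewrite -sum1_card -(big_ord_widen _ (fun=> 1%N) db1) /=.
  by rewrite sum1_card card_ord.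
rewrite card_family foldrE big_map big_enum /= (eq_bigr _ (fun i _ => cF i)).
rewrite (bigID (fun i : 'I_n => (i < l)%N)) /=.
rewrite (eq_bigr (fun=> d.-1)) => [|i ->] //.
rewrite [X in (_ * X)%N](eq_bigr (fun=> b)) => [|i /negbTE->] //.
rewrite !prod_nat_const.
have c1 : #|[pred i : 'I_n | (i < l)%N]| = l.
  by rewrite -sum1_card -(big_ord_widen _ (fun=> 1%N) ln) /= sum1_card card_ord.
have c2 : #|[pred i : 'I_n | ~~ (i < l)%N]| = (n - l)%N.
  have := cardC [pred i : 'I_n | (i < l)%N]; rewrite c1 card_ord => e.
  by apply: (@addnI l); rewrite subnKC.
by congr (_ ^ _ * _ ^ _)%N.
Qed.
End Coding.

(** * The averaged Hansel inequality for one code *)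

Section CodingInequality.
Variables (R : realType) (b0 n d fuel : nat) (C : {set word b0.+1 n}).
Let b := b0.+1.
Hypotheses (d1 : (1 < d)%N) (db : (d < b)%N).
Hypotheses (hashC : is_hash_code d.+2 C) (ok : search_ok fuel b d).
Variable l : nat.
Hypotheses (ln : (l <= n)%N) (dC : (d < #|C|)%N).

Let win := window d C l.
Let D := (d.-1 ^ l * b ^ (n - l))%N.
Let N := #|C|.
Let lam (s : word b n) : R := #|win s|%:R.
(** Uniform distribution on the subcode, identically 0 when the subcode is empty. *)
Let h (s w : word b n) : R := (w \in win s)%:R / lam s.
Let p (i : 'I_n) (s : word b n) (a : 'I_b) : R := \sum_(w : word b n | w i == a) h s w.
Let q (i : 'I_n) (a : 'I_b) : R := #|[set w : word b n in C | w i == a]|%:R / N%:R.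

Lemma win_sub s w : w \in win s -> w \in C.
Proof. by rewrite finset.in_set => /andP[]. Qed.

Lemma sum_windows (P : pred (word b n)) :
  (\sum_s #|[set w in win s | P w]| = #|[set w in C | P w]| * D)%N.
Proof.
have E s : (#|[set w in win s | P w]| =
    \sum_(w in [set w in C | P w]) if w \in win s then 1 else 0)%N.
  rewrite -sum1_card -big_mkcondr; apply: eq_bigl => w; rewrite !finset.in_set.
  by case: (w \in C); case: (P w); rewrite ?andbF ?andbT.
under eq_bigr => s _ do rewrite E.
rewrite exchange_big /= -sum_nat_const; apply: eq_bigr => w.
rewrite finset.in_set => /andP[wC _].
by rewrite -big_mkcond sum1dep_card; exact: card_windows.
Qed.

Lemma lam_ge0 s : 0 <= lam s. Proof. exact: ler0n. Qed.

Lemma h_ge0 s w : 0 <= h s w.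
Proof. by rewrite /h divr_ge0 ?lam_ge0 ?ler0n. Qed.

Lemma lam_h s w : lam s * h s w = (w \in win s)%:R.
Proof.
have [l0|l0] := eqVneq (lam s) 0; last by rewrite /h mulrC divfK.
have /eqP w0 : win s == finset.set0 by rewrite -cards_eq0 -(pnatr_eq0 R) -/(lam s) l0.
by rewrite l0 mul0r w0 finset.in_set0.
Qed.

Lemma sum_h s : lam s != 0 -> \sum_w h s w = 1.
Proof.
move=> l0; rewrite -mulr_suml; apply/(canLR (mulfK l0)).
by rewrite mul1r -natr_sum /lam -sum1_card [in RHS]big_mkcond; congr _%:R;
  apply: eq_bigr => w _; case: (w \in win s).
Qed.

Lemma lam_p i s a : lam s * p i s a = #|[set w in win s | w i == a]|%:R.
Proof.
rewrite mulr_sumr (eq_bigr (fun w => (w \in win s)%:R)) => [|w _]; last exact: lam_h.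
rewrite -natr_sum -sum1dep_card big_mkcond [in RHS]big_mkcond; congr _%:R.
by apply: eq_bigr => w _; case: (w i == a); case: (w \in win s).
Qed.

Lemma N_gt0 : 0 < N%:R :> R.
Proof. by rewrite ltr0n (leq_ltn_trans _ dC). Qed.

Lemma D_gt0 : (0 < D)%N.
Proof. by rewrite muln_gt0 !expn_gt0 /= -ltnS prednK ?d1 // ltnW. Qed.

Lemma sum_lam : \sum_s lam s = N%:R * D%:R.
Proof.
have := sum_windows predT; rewrite /lam -natr_sum -natrM => e; congr _%:R.
have c (A : {set word b n}) : [set w in A | predT w] = A.
  by apply/setP => w; rewrite finset.in_set andbT.
by move: e; rewrite c => <-; apply: eq_bigr => s _; rewrite c.
Qed.

(** Pigeonhole: [d] words share a window of [d.-1] symbols. *)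
Lemma window_collides (i : 'I_n) s (x : seq (word b n)) : (i < l)%N ->
  size x = d -> {subset x <= win s} -> uniq (symbols x i) = false.
Proof.
move=> il sx sub; apply/negP => u.
have inj : injective (fun a : 'I_b => a - s i) by move=> a c /addIr.
pose y := [seq nat_of_ord (w i - s i)%R | w : word b n <- x].
have uy : uniq y.
  rewrite -(map_inj_uniq inj) in u.
  rewrite -(map_inj_uniq (@ord_inj _)) in u.
  by rewrite /y; move: u; rewrite /symbols -!map_comp.
have ys : {subset y <= iota 0 d.-1}.
  move=> _ /mapP[w wx ->]; rewrite mem_iota add0n /=.
  have := sub w wx; rewrite finset.in_set => /andP[_ /forallP/(_ i)].
  by rewrite il.
have := uniq_leq_size uy ys; rewrite size_iota size_map sx.
by rewrite -ltnS prednK ?ltnn // ltnW.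
Qed.

(** Expected number of words [v] that, with [d] draws from the subcode, have pairwise distinct
    symbols at [i]. *)
Let coll (i : 'I_n) (s : word b n) : R :=
  \sum_(v in C) iid (h s) d (fun x => (uniq (v i :: symbols x i))%:R).

(** Grouping the words [v] by their symbol at [i] yields [N * q]; pushing [h s] forward yields
    [p i s]. *)
Lemma coll_late i s : coll i s =
  N%:R * mixed_inj [seq (p i s a, q i a) | a <- enum 'I_b] d.
Proof.
rewrite -iid_mixed_inj mulr_sumr /coll.
rewrite (partition_big (fun v : word b n => v i) xpredT) //=.
apply: eq_bigr => c _.
rewrite (eq_bigr (fun=> iid (p i s) d (fun y => (uniq (c :: y))%:R))) => [|v /andP[_ /eqP vc]].
  rewrite sumr_const mulrA -[_ *+ _]mulr_natl; congr (_ * _).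
  rewrite /q mulrCA divff ?gt_eqF ?N_gt0 // mulr1; congr _%:R.
  by apply: fintype.eq_card => w; rewrite finset.in_set unfold_in.
by rewrite -vc -(iid_push (h s) (fun w : word b n => w i) d
  (fun y => (uniq (v i :: y))%:R)).
Qed.

Lemma coll_early (i : 'I_n) s : (i < l)%N -> coll i s = 0.
Proof.
move=> il; rewrite /coll big1 // => v _; apply/le_anti/andP; split; last first.
  by apply: iid_ge0 => //; exact: h_ge0.
(* Scaling by 0 also covers an empty subcode, where [h s] has total mass 0. *)
have <- : iid (h s) d (fun=> 0 * 0) = 0 by rewrite iidZ mul0r.
apply: iid_le => [|x sx hx]; first exact: h_ge0.
rewrite mul0r /= (window_collides (s := s) il sx) ?andbF // => w wx.
have := allP hx _ wx; rewrite /h.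
by case: (w \in win s); rewrite ?mul0r ?eqxx.
Qed.

(** [hansel_ln] is averaged over the starts [s], weighted by subcode size, and over [d] draws from
    each subcode. *)
Lemma coding_ineq :
  (N%:R * D%:R - (d ^ 2)%:R * b%:R ^+ n) * ((N - d)%:R * exp.ln (N - d)%:R)
    * b%:R ^+ d.+1
  <= exp.ln (b - d)%:R * (n - l)%:R * (N%:R * (N%:R * D%:R)) * (b ^_ d.+1)%:R :> R.
Proof.
have [L LE] : exists L : R, L = (N - d)%:R * exp.ln (N - d)%:R by eexists.
rewrite -LE; have L0 : 0 <= L by rewrite LE mulr_ge0 ?ler0n // ln_ge0 // ler1n subn_gt0.
have lm0 : 0 <= exp.ln (b - d)%:R :> R by rewrite ln_ge0 // ler1n subn_gt0.
(* Repeated draws cost at most [d ^ 2] for each of the [b ^ n] starts, because [h s] is at most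
   [1 / lam s]. *)
have step1 : (N%:R * D%:R - (d ^ 2)%:R * b%:R ^+ n) * L <=
    \sum_s lam s * iid (h s) d (fun x => L * (uniq x)%:R).
  rewrite (_ : _ - _ = \sum_(s : word b n) (lam s - (d ^ 2)%:R)); last first.
    rewrite sumrB sum_lam sumr_const card_ffun !card_ord -natrX; congr (_ - _).
    exact: mulr_natr.
  rewrite mulr_suml; apply: ler_sum => s _; rewrite iidZ mulrCA [leLHS]mulrC.
  rewrite ler_wpM2l //.
  have [l0|l0] := eqVneq (lam s) 0.
    by rewrite l0 mul0r sub0r oppr_le0 ler0n.
  have lp : 0 < lam s by rewrite lt_neqAle eq_sym l0 lam_ge0.
  have he w : h s w <= (lam s)^-1.
    rewrite /h -[leRHS]mul1r ler_wpM2r ?invr_ge0 ?lam_ge0 //.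
    by case: (w \in win s); rewrite ?ler01.
  have := ler_wpM2l (lam_ge0 s) (iid_uniq_ge (h_ge0 s) (sum_h l0) d he).
  apply: le_trans.
  by rewrite mulrBr mulr1 mulrCA divff // mulr1.
have step2 : \sum_s lam s * iid (h s) d (fun x => L * (uniq x)%:R) <=
    exp.ln (b - d)%:R * \sum_(i < n) \sum_s lam s * coll i s.
  rewrite exchange_big mulr_sumr; apply: ler_sum => s _ /=.
  rewrite -mulr_sumr mulrCA ler_wpM2l ?lam_ge0 //.
  rewrite /coll exchange_big /=.
  have -> : exp.ln (b - d)%:R * \sum_(v in C) \sum_(i < n)
        iid (h s) d (fun x => (uniq (v i :: symbols x i))%:R) =
      iid (h s) d (fun x => exp.ln (b - d)%:R *
        \sum_(v in C) \sum_i (uniq (v i :: symbols x i))%:R).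
    rewrite iidZ; congr (_ * _); rewrite iid_sum; apply: eq_bigr => v _.
    by rewrite iid_sum.
  apply: iid_le => [|x sx hx]; first exact: h_ge0.
  have xC : {subset x <= C}.
    move=> w wx; apply: (@win_sub s); have := allP hx _ wx; rewrite /h.
    by case: (w \in win s); rewrite ?mul0r ?eqxx.
  have [ux|ux] := boolP (uniq x); last first.
    by rewrite mulr0 mulr_ge0 // sumr_ge0 // => v _; rewrite sumr_ge0.
  by rewrite mulr1 LE; exact: hansel_ln.
(* The first [l] coordinates contribute nothing; [average_mixed_inj] bounds each of the others. *)
have step3 : b%:R ^+ d.+1 * \sum_(i < n) \sum_s lam s * coll i s <=
    (n - l)%:R * (N%:R * (N%:R * D%:R) * (b ^_ d.+1)%:R).
  have -> : (n - l)%:R * (N%:R * (N%:R * D%:R) * (b ^_ d.+1)%:R) =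
     \sum_(i < n | (l <= i)%N) N%:R * (N%:R * D%:R) * (b ^_ d.+1)%:R :> R.
    rewrite sumr_const mulr_natl; congr (_ *+ _).
    have c1 : #|[pred i : 'I_n | (i < l)%N]| = l.
      by rewrite -sum1_card -(big_ord_widen _ (fun=> 1%N) ln) /= sum1_card card_ord.
    have := cardC [pred i : 'I_n | (i < l)%N]; rewrite c1 card_ord => e.
    apply: (@addnI l); rewrite subnKC // -[LHS]e; congr (_ + _)%N.
    by apply: fintype.eq_card => i; rewrite !inE -leqNgt.
  rewrite mulr_sumr [leRHS]big_mkcond /=; apply: ler_sum => i _.
  case: (leqP l i) => li; last first.
    by rewrite big1 ?mulr0 // => s _; rewrite coll_early // mulr0.
  under eq_bigr => s _ do rewrite coll_late mulrCA.
  rewrite -mulr_sumr mulrCA -[leRHS]mulrA ler_wpM2l ?ler0n //.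
  rewrite -sum_lam; apply: (average_mixed_inj d1 _ ok).
  - exact: leq_trans d1 (ltnW db).
  - exact: lam_ge0.
  - by rewrite sum_lam mulr_gt0 ?N_gt0 // ltr0n D_gt0.
  - by move=> s a; apply: sumr_ge0 => w _; exact: h_ge0.
  - move=> s /sum_h <-; rewrite (partition_big (fun w : word b n => w i) xpredT) //=.
  - move=> a; under [RHS]eq_bigr => s _ do rewrite lam_p.
    have N0 : N%:R != 0 :> R by rewrite gt_eqF // N_gt0.
    rewrite sum_lam -natr_sum sum_windows natrM [N%:R * _]mulrC -mulrA.
    by rewrite [N%:R * _]mulrC divfK // mulrC.
have b0' : 0 <= b%:R ^+ d.+1 :> R by rewrite exprn_ge0.
apply: le_trans (ler_wpM2r b0' (le_trans step1 step2)) _.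
rewrite -[leLHS]mulrA -[leRHS]mulrA -[leRHS]mulrA ler_wpM2l //.
by rewrite [leLHS]mulrC.
Qed.

End CodingInequality.

(** * Asymptotics *)

(** The loss [2 * eta * n * r] is at most half of [n * (r - t)]; the other half exceeds [c + 1]. *)
Lemma rate_contradiction (R : realFieldType) (n r t c eta : R) : 0 < eta ->
  (1 - 2 * eta) * (n * r - 1) <= n * t + c ->
  n * (4 * eta * r) <= n * (r - t) -> 2 * (c + 1) < n * (r - t) -> False.
Proof. by move=> ? ? ? ?; lra. Qed.

Section Rate.
Variables (R : realType) (b0 d fuel : nat).
Let b := b0.+1.
Hypotheses (d1 : (1 < d)%N) (db : (d < b)%N) (ok : search_ok fuel b d).

(** Division by [N ^ 2 * D * b ^ (d + 1)], where [D] counts the starts whose window contains a given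
    word. *)
Lemma coding_ineq_normalized n (C : {set word b n}) l : is_hash_code d.+2 C ->
  (l <= n)%N -> (d < #|C|)%N ->
  (1 - (d ^ 2)%:R * ((b%:R / d.-1%:R) ^+ l / #|C|%:R))
    * ((1 - d%:R / #|C|%:R) * ln (#|C| - d)%:R)
  <= ln (b - d)%:R * ((b ^_ d.+1)%:R / b%:R ^+ d.+1) * (n%:R - l%:R) :> R.
Proof.
move=> hC ln dC; have := coding_ineq R d1 db hC ok ln dC.
set N := #|C|; rewrite natrM !natrX !natrB // ?(ltnW dC) //; last exact: ltnW.
have N0 : 0 < N%:R :> R by rewrite ltr0n (leq_ltn_trans _ dC).
have bR : 0 < b%:R :> R by rewrite ltr0n.
have tR : 0 < d.-1%:R :> R by rewrite ltr0n -ltnS prednK // ltnW.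
have bE : b%:R ^+ n = b%:R ^+ l * b%:R ^+ (n - l) :> R by rewrite -exprD subnKC.
have : 0 < d.-1%:R ^+ l :> R by rewrite exprn_gt0.
have : 0 < b%:R ^+ (n - l) :> R by rewrite exprn_gt0.
have : 0 < b%:R ^+ d.+1 :> R by rewrite exprn_gt0.
have : (b%:R / d.-1%:R) ^+ l = b%:R ^+ l / d.-1%:R ^+ l :> R by rewrite expr_div_n.
move=> ->; rewrite bE.
move: (exp.ln _) (exp.ln _) ((b ^_ _)%:R) (b%:R ^+ d.+1).
move: (b%:R ^+ (n - l)) (b%:R ^+ l) (d.-1%:R ^+ l).
move=> U V T y x F B B0 U0 T0 key.
rewrite -(ler_pM2r (_ : 0 < N%:R * (N%:R * (T * U)) * B)); last first.
  by rewrite !mulr_gt0.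
have nz : N%:R != 0 :> R by rewrite gt_eqF.
have Tz : T != 0 by rewrite gt_eqF.
have Uz : U != 0 by rewrite gt_eqF.
have Bz : B != 0 by rewrite gt_eqF.
set lhs := (X in X <= _); set rhs := (X in _ <= X).
have -> : lhs = (N%:R * (T * U) - d%:R ^+ 2 * (V * U)) * ((N%:R - d%:R) * x) * B.
  by rewrite /lhs; field; rewrite nz Tz.
have -> : rhs = y * (n%:R - l%:R) * (N%:R * (N%:R * (T * U))) * F.
  by rewrite /rhs; field; rewrite Bz.
exact: key.
Qed.

Variables r rho : R.
Let c : R := ln (b - d)%:R * ((b ^_ d.+1)%:R / b%:R ^+ d.+1).
Hypotheses (r0 : 0 < r) (rho0 : 0 < rho) (rho1 : rho < 1).
Hypothesis rate1 : c * (1 - rho) < r.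
Hypothesis rate2 : rho * ln (b%:R / d.-1%:R) < r.

(** Take windows on about [rho * n] coordinates. For a code larger than [expR (n * r)], [rate2]
    makes the error from repeated draws vanish, and the limiting bound [c * (1 - rho)] contradicts
    [rate1]. *)
Lemma ln_hash_code_le : exists n0, forall n, (n0 <= n)%N ->
  forall C : {set word b n}, is_hash_code d.+2 C -> ln #|C|%:R <= n%:R * r.
Proof.
pose t := c * (1 - rho); pose dl := r - rho * ln (b%:R / d.-1%:R).
have rt : 0 < r - t by rewrite subr_gt0.
have dl0 : 0 < dl by rewrite subr_gt0.
pose eta := Num.min (1 / 4) ((r - t) / (4 * r)).
have eta0 : 0 < eta by rewrite lt_min !divr_gt0 ?mulr_gt0.
have eta4 : eta <= 1 / 4 by rewrite ge_min lexx.
have etar : 4 * eta * r <= r - t.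
  by rewrite mulrAC -ler_pdivlMl ?mulr_gt0 // mulrC ge_min lexx orbT.
have c0 : 0 <= c.
  by rewrite mulr_ge0 ?ln_ge0 ?ler1n ?subn_gt0 // divr_ge0 // exprn_ge0.
(* One summand for each of the thresholds [n1], [n2], [n3], [n4] below. *)
pose K := d%:R ^+ 2 / (eta * dl) + d%:R / (eta * r) + 2 * (c + 1) / (r - t) + 1 / r.
have K1 : 0 <= d%:R ^+ 2 / (eta * dl) by rewrite divr_ge0 ?sqr_ge0 // ltW // mulr_gt0.
have K2 : 0 <= d%:R / (eta * r) by rewrite divr_ge0 // ltW // mulr_gt0.
have K3 : 0 <= 2 * (c + 1) / (r - t) by rewrite divr_ge0 ?(ltW rt) // mulr_ge0 // addr_ge0.
have K4 : 0 <= 1 / r by rewrite divr_ge0 // ltW.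
have K0 : 0 <= K by rewrite !addr_ge0.
exists (Num.trunc K).+1 => n nK C hC; rewrite leNgt; apply/negP => nr.
have {nK} Kn : K < n%:R.
  have /andP[_ h] := truncn_itv K0.
  by apply: lt_le_trans h _; rewrite ler_nat.
have n0 : 0 < n%:R :> R by apply: le_lt_trans Kn.
pose N : R := #|C|%:R.
(* An empty code is excluded because [ln 0 = 0]. *)
have N0 : 0 < N.
  rewrite ltr0n lt0n; apply/negP => /eqP e; move: nr; rewrite e ln0 // ltNge.
  by rewrite mulr_ge0 // ltW.
have expN : expR (n%:R * r) < N by rewrite -[ltRHS]lnK // ltr_expR.
have nr0 : 0 < n%:R * r by rewrite mulr_gt0.
have n1 : d%:R ^+ 2 <= eta * (n%:R * dl).
  have : d%:R ^+ 2 / (eta * dl) <= n%:R by apply: le_trans (ltW Kn); rewrite /K; lra.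
  by rewrite ler_pdivrMr ?mulr_gt0 // mulrCA.
have n2 : d%:R <= eta * (n%:R * r).
  have : d%:R / (eta * r) <= n%:R by apply: le_trans (ltW Kn); rewrite /K; lra.
  by rewrite ler_pdivrMr ?mulr_gt0 // mulrCA.
have n3 : 2 * (c + 1) < n%:R * (r - t).
  have : 2 * (c + 1) / (r - t) < n%:R by apply: le_lt_trans Kn; rewrite /K; lra.
  by rewrite ltr_pdivrMr.
have n4 : 1 <= n%:R * r.
  have : 1 / r <= n%:R by apply: le_trans (ltW Kn); rewrite /K; lra.
  by rewrite ler_pdivrMr.
have dN : d%:R / N <= eta.
  rewrite ler_pdivrMr //; apply: le_trans n2 _; rewrite ler_pM2l // ltW //.
  by apply: lt_trans expN; apply: lt_le_trans (expR_ge1Dx _); rewrite ltrDr.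
have dC : (d < #|C|)%N.
  rewrite -(ltr_nat R) -/N -[ltRHS]mul1r -ltr_pdivrMr //.
  by apply: le_lt_trans dN _; apply: le_lt_trans eta4 _; lra.
pose l := Num.trunc (rho * n%:R).
have /andP[l1 l2] := truncn_itv (ltW (mulr_gt0 rho0 n0)); rewrite -/l in l1 l2.
have ln : (l <= n)%N.
  rewrite -(ler_nat R); apply: le_trans l1 _.
  by rewrite -[leRHS]mul1r ler_pM2r // ltW.
have bt1 : 1 <= b%:R / d.-1%:R :> R.
  have tR : 0 < d.-1%:R :> R by rewrite ltr0n -ltnS prednK // ltnW.
  by rewrite ler_pdivlMr // mul1r ler_nat (leq_trans (leq_pred _)) // ltnW.
have bt0 : 0 < b%:R / d.-1%:R :> R by apply: lt_le_trans bt1.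
have frac : (b%:R / d.-1%:R) ^+ l / N <= (n%:R * dl)^-1.
  rewrite -[_ ^+ l]lnK ?posrE ?exprn_gt0 // lnXn //.
  apply: (@le_trans _ _ (expR (rho * n%:R * exp.ln (b%:R / d.-1%:R)) / expR (n%:R * r))).
    rewrite ler_pM ?expR_ge0 ?invr_ge0 ?(ltW N0) // ?ler_expR.
      by rewrite -[leLHS]mulr_natl ler_wpM2r // ln_ge0.
    by rewrite lef_pV2 ?posrE ?expR_gt0 // ltW.
  rewrite -expRN -expRD.
  rewrite (_ : _ + _ = - (n%:R * dl)); last by rewrite /dl; ring.
  rewrite expRN lef_pV2 ?posrE ?expR_gt0 ?mulr_gt0 //.
  by apply: le_trans (expR_ge1Dx _); rewrite lerDr.
have A1 : 1 - eta <= 1 - (d ^ 2)%:R * ((b%:R / d.-1%:R) ^+ l / N).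
  rewrite lerD2l lerN2 natrX; apply: (@le_trans _ _ (d%:R ^+ 2 * (n%:R * dl)^-1)).
    by rewrite ler_wpM2l // sqr_ge0.
  by rewrite ler_pdivrMr // mulr_gt0.
have A2 : 1 - eta <= 1 - d%:R / N by rewrite lerD2l lerN2.
have A3 : n%:R * r - 1 <= exp.ln (#|C| - d)%:R.
  have h2 : N / 2 <= (#|C| - d)%:R.
    rewrite natrB ?(ltnW dC) // -/N.
    have : d%:R <= eta * N by rewrite -ler_pdivrMr.
    have : eta * N <= 1 / 4 * N by rewrite ler_wpM2r // ltW.
    lra.
  have N2 : 0 < N / 2 by rewrite divr_gt0.
  apply: (@le_trans _ _ (exp.ln (N / 2))); last by rewrite ler_ln // posrE (lt_le_trans N2).
  rewrite ln_div ?posrE //; have : exp.ln (2 : R) <= 1.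
    by rewrite (_ : 2 = 1 + 1) // le_ln1Dx // (lt_trans (ltrN10 _)).
  by move: nr; rewrite -/N; lra.
have key := coding_ineq_normalized hC ln dC; rewrite -/c -/N in key.
have e1 : 0 < 1 - eta by lra.
have low : (1 - eta) * ((1 - eta) * (n%:R * r - 1)) <= c * (n%:R - l%:R).
  apply: le_trans key; apply: ler_pM => //; first exact: ltW.
    by rewrite mulr_ge0 ?(ltW e1) // subr_ge0.
  by apply: ler_pM => //; [exact: ltW|rewrite subr_ge0].
(* Rounding [rho * n] down costs at most one coordinate, hence the extra [c]. *)
have up : c * (n%:R - l%:R) <= n%:R * t + c.
  rewrite (_ : n%:R * t + c = c * (n%:R * (1 - rho) + 1)); last by rewrite /t; ring.
  by rewrite ler_wpM2l //; lra.
have h1 : (1 - 2 * eta) * (n%:R * r - 1) <= (1 - eta) * ((1 - eta) * (n%:R * r - 1)).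
  by rewrite mulrA ler_wpM2r ?subr_ge0 // -subr_ge0 (_ : _ - _ = eta ^+ 2) ?sqr_ge0 //; ring.
have h2 : n%:R * (4 * eta * r) <= n%:R * (r - t) by rewrite ler_pM2l.
have {}up := le_trans (le_trans h1 low) up.
exact: rate_contradiction eta0 up h2 n3.
Qed.
End Rate.

(** * From codes to rates, and the numerical certificates *)

Section Final.
Variable R : realType.

Lemma hash_code0 b k n : (0 < k)%N -> is_hash_code k (finset.set0 : {set word b n}).
Proof.
move=> k0; apply/forallP => S; apply/implyP => /andP[/fintype.subsetP sub /eqP Sk].
have : S = finset.set0 by apply/eqP; rewrite -finset.subset0; apply/fintype.subsetP.
by move=> S0; move: k0; rewrite -Sk S0 cards0.
Qed.

Lemma limn_esup_le (u : nat -> \bar R) (r : \bar R) n0 :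
  (forall n, (n0 <= n)%N -> (u n <= r)%E) -> (limn_esup u <= r)%E.
Proof.
move=> ur; apply: (@le_trans _ _ (ereal_sup (u @` [set n | (n0 <= n)%N])%classic)).
  by apply: ereal_inf_lbound; exists [set n | (n0 <= n)%N]%classic => //; exists n0.
by apply: ge_ereal_sup => _ [n /= hn <-]; exact: ur.
Qed.

Lemma R_hash_le b0 d fuel (r rho : R) : (1 < d)%N -> (d < b0.+1)%N ->
  search_ok fuel b0.+1 d -> 0 < r -> 0 < rho -> rho < 1 ->
  ln (b0.+1 - d)%:R * ((b0.+1 ^_ d.+1)%:R / b0.+1%:R ^+ d.+1) * (1 - rho) < r * ln 2 ->
  rho * ln (b0.+1%:R / d.-1%:R) < r * ln 2 ->
  (R_hash R b0.+1 d.+2 <= r%:E)%E.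
Proof.
move=> d1 db ok r0 rho0 rho1 h1 h2.
have l20 : 0 < ln 2 :> R by rewrite ln_gt0 // ltr1n.
have [n0 H] := ln_hash_code_le d1 db ok (mulr_gt0 r0 l20) rho0 rho1 h1 h2.
(* Starting at [n0.+1] ensures a positive length to divide by. *)
apply: (@limn_esup_le _ _ n0.+1) => n nn0; rewrite lee_fin.
have n1 : 0 < n%:R :> R by rewrite ltr0n (leq_ltn_trans _ nn0).
rewrite mulrC ler_pdivrMr // /log2 ler_pdivrMr // mulrC mulrA mulrC mulrA mulrC.
pose hc := [pred C : {set word b0.+1 n} | is_hash_code d.+2 C].
have hc0 : (0 < #|hc|)%N.
  by apply/card_gt0P; exists finset.set0; exact: hash_code0.
have [C hC e] := eq_bigmax_cond (fun C : {set word b0.+1 n} => #|C|) hc0.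
rewrite (_ : N_hash b0.+1 d.+2 n = #|C|); last exact: e.
by rewrite [leRHS](_ : _ = n%:R * (r * ln 2)); [exact: H (ltnW nn0) _ hC|ring].
Qed.

Lemma ln_le_ln2 (x : R) a c : 0 < x -> x ^+ a <= 2 ^+ c ->
  a%:R * ln x <= c%:R * ln 2.
Proof.
move=> x0 h; rewrite !mulr_natl -!lnXn // ler_ln // posrE exprn_gt0 //.
Qed.

(* [2 ^ (c / a)] bounds [b - d] from above and [2 ^ (v / w)] bounds
   [b / (d - 1)] from above; [pn / pd] is the density of the windowed
   coordinates. *)
Definition rate_ok (b d : nat) (rn rd pn pd : N) (a c w v : nat) : bool :=
  let pow x k := (x ^ N.of_nat k)%num in
  [&& (pow (N.of_nat (b - d)) a <=? pow 2 c)%num,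
      (pow (N.of_nat b) w <=? pow 2 v * pow (N.of_nat d.-1) w)%num,
      (pn * N.of_nat v * rd <? rn * N.of_nat w * pd)%num &
      (ffactN b d.+1 * N.of_nat c * (pd - pn) * rd
       <? rn * N.of_nat a * pd * pow (N.of_nat b) d.+1)%num].

Lemma toR_lt m n : (m <? n)%num -> toR R m < toR R n.
Proof. by move=> h; rewrite ltr_nat; move: h => /N.ltb_lt; lia. Qed.

(** Both logarithms are replaced by rational multiples of [ln 2], which then cancels and leaves
    integer inequalities. *)
Lemma R_hash_rational_le b0 d fuel rn rd pn pd a c w v :
  search_ok fuel b0.+1 d -> rate_ok b0.+1 d rn rd pn pd a c w v ->
  [&& 1 < d, d < b0.+1, 0 < a & 0 < w]%N ->
  [&& 0 <? rn, 0 <? rd, 0 <? pn & pn <? pd]%num ->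
  (R_hash R b0.+1 d.+2 <= (toR R rn / toR R rd)%:E)%E.
Proof.
move=> ok /and4P[h1 h2 h3 h4] /and4P[d1 db a0 w0] /and4P[rn0 rd0 pn0 pnd].
have l20 : 0 < ln 2 :> R by rewrite ln_gt0 // ltr1n.
have {}rn0 := toR_lt rn0; have {}rd0 := toR_lt rd0; have {}pn0 := toR_lt pn0.
have {}pnd := toR_lt pnd; rewrite toR0 in rn0 rd0 pn0.
have pd0 : 0 < toR R pd by apply: lt_trans pnd.
have bd0 : 0 < (b0.+1 - d)%:R :> R by rewrite ltr0n subn_gt0.
have tR : 0 < d.-1%:R :> R by rewrite ltr0n -ltnS prednK // ltnW.
have a0R : 0 < a%:R :> R by rewrite ltr0n.
have w0R : 0 < w%:R :> R by rewrite ltr0n.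
have {h1} /(ln_le_ln2 bd0) h1 : (b0.+1 - d)%:R ^+ a <= 2 ^+ c :> R.
  by have := toR_le R h1; rewrite !toRX toR_nat.
have {h2} /(ln_le_ln2 (divr_gt0 _ tR)) h2 : (b0.+1%:R / d.-1%:R) ^+ w <= 2 ^+ v :> R.
  have := toR_le R h2; rewrite toRM !toRX !toR_nat expr_div_n.
  by rewrite ler_pdivrMr // exprn_gt0.
have {}h2 := h2 (ltr0Sn _ _).
apply: (R_hash_le (rho := toR R pn / toR R pd) d1 db ok).
- exact: divr_gt0.
- exact: divr_gt0.
- by rewrite ltr_pdivrMr // mul1r.
- have {}h4 := toR_lt h4; rewrite 3!toRM toR_ffact !toRM toRX !toR_nat in h4.
  have pp : toR R pd - toR R pn <= toR R (pd - pn) by exact: toR_sub.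
  have B0 : 0 < b0.+1%:R ^+ d.+1 :> R by rewrite exprn_gt0.
  set F := (b0.+1 ^_ d.+1)%:R in h4 *; set B := b0.+1%:R ^+ d.+1 in h4 B0 *.
  have F0 : 0 <= F by exact: ler0n.
  have {}h4 : F * c%:R * (toR R pd - toR R pn) * toR R rd <
      toR R rn * a%:R * toR R pd * B.
    apply: le_lt_trans h4; rewrite ler_wpM2r ?(ltW rd0) // ler_wpM2l //.
    by rewrite mulr_ge0.
  rewrite -(ltr_pM2l (_ : 0 < a%:R * B * toR R pd * toR R rd)); last by rewrite !mulr_gt0.
  have nz1 : toR R pd != 0 by rewrite gt_eqF.
  have nz2 : toR R rd != 0 by rewrite gt_eqF.
  have nz3 : B != 0 by rewrite gt_eqF.
  set lhs := (X in X < _); set rhs := (X in _ < X).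
  have -> : lhs = (a%:R * ln (b0.+1 - d)%:R) * (F * (toR R pd - toR R pn) * toR R rd).
    by rewrite /lhs; field; rewrite nz3 nz1.
  have -> : rhs = (toR R rn * a%:R * toR R pd * B) * ln 2.
    by rewrite /rhs; field; rewrite nz2.
  apply: (@le_lt_trans _ _ ((F * c%:R * (toR R pd - toR R pn) * toR R rd) * ln 2)).
    rewrite (_ : _ * ln 2 =
      (c%:R * ln 2) * (F * (toR R pd - toR R pn) * toR R rd)); last by ring.
    by rewrite ler_wpM2r // !mulr_ge0 // ?subr_ge0 ltW.
  by rewrite ltr_pM2r.
- have {}h3 := toR_lt h3; rewrite !toRM !toR_nat in h3.
  rewrite -(ltr_pM2l (_ : 0 < w%:R * toR R pd * toR R rd)); last by rewrite !mulr_gt0.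
  have nz1 : toR R pd != 0 by rewrite gt_eqF.
  have nz2 : toR R rd != 0 by rewrite gt_eqF.
  set lhs := (X in X < _); set rhs := (X in _ < X).
  have -> : lhs = (w%:R * ln (b0.+1%:R / d.-1%:R)) * (toR R pn * toR R rd).
    by rewrite /lhs; field.
  have -> : rhs = (toR R rn * w%:R * toR R pd) * ln 2.
    by rewrite /rhs; field.
  apply: (@le_lt_trans _ _ ((toR R pn * v%:R * toR R rd) * ln 2)).
    rewrite (_ : _ * ln 2 = (v%:R * ln 2) * (toR R pn * toR R rd)); last by ring.
    by rewrite ler_wpM2r // mulr_ge0 // ltW.
  by rewrite ltr_pM2r.
Qed.

(** States the bound in the form of large decimal literals, so that the arithmetic stays binary. *)
Lemma R_hash_decimal_le b0 d fuel (rn rd : Decimal.uint) pn pd a c w v :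
  search_ok fuel b0.+1 d ->
  rate_ok b0.+1 d (N.of_uint rn) (N.of_uint rd) pn pd a c w v ->
  [&& 1 < d, d < b0.+1, 0 < a & 0 < w]%N ->
  [&& 0 <? N.of_uint rn, 0 <? N.of_uint rd, 0 <? pn & pn <? pd]%num ->
  (R_hash R b0.+1 d.+2 <= ((Nat.of_num_uint (Number.UIntDecimal rn))%:R
                           / (Nat.of_num_uint (Number.UIntDecimal rd))%:R)%:E)%E.
Proof.
move=> ok h1 h2 h3; have := R_hash_rational_le ok h1 h2 h3.
by rewrite /toR !common.uint_N_nat.
Qed.

End Final.

(** The 20 limits the subdivision depth; 18 halvings of the initial square reach unit cells. *)
Lemma search_ok_7_5 : search_ok 20 7 5.
Proof. vm_cast_no_check (erefl true). Qed.

Lemma search_ok_8_6 : search_ok 20 8 6.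
Proof. vm_cast_no_check (erefl true). Qed.

Lemma search_ok_9_6 : search_ok 20 9 6.
Proof. vm_cast_no_check (erefl true). Qed.

Lemma search_ok_10_7 : search_ok 20 10 7.
Proof. vm_cast_no_check (erefl true). Qed.

Lemma search_ok_11_8 : search_ok 20 11 8.
Proof. vm_cast_no_check (erefl true). Qed.

Local Open Scope ereal_scope.

Theorem theorem1 (R : realType) :
  [/\ R_hash R 7 7 <= (408975%:R / 10000000%:R : R)%:E,
      R_hash R 8 8 <= (188887%:R / 10000000%:R : R)%:E,
      R_hash R 9 8 <= (561537%:R / 10000000%:R : R)%:E,
      R_hash R 10 9 <= (277279%:R / 10000000%:R : R)%:E
    & R_hash R 11 10 <= (132033%:R / 10000000%:R : R)%:E].
Proof.
split.
(* Here and below [rho = pn / pd] lies between [1 - r * ln 2 / c] and [r * ln 2 / ln (b / (d - 1))];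
   the ratio 485/306 is a close upper bound for the binary logarithm of 3. *)
- by apply: (@R_hash_decimal_le R 6 5 20 _ _ 48 1000 1 1 6 5 search_ok_7_5).
- by apply: (@R_hash_decimal_le R 7 6 20 _ _ 2 100 1 1 10 7 search_ok_8_6).
- by apply: (@R_hash_decimal_le R 8 6 20 _ _ 661 10000 306 485 33 28 search_ok_9_6).
- by apply: (@R_hash_decimal_le R 9 7 20 _ _ 365 10000 306 485 4 3 search_ok_10_7).
- by apply: (@R_hash_decimal_le R 10 8 20 _ _ 18 1000 306 485 3 2 search_ok_11_8).
Qed.
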